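(* Let $G$ be a weak Schur $\sigma$-group. If $G$ is finite, then the subset $\{[G]\}\subset\mathrm{Sch}$ is open and closed, and it has measure $$\mu_\infty(\{[G]\})\ =\ \frac{C_\infty}{|\mathrm{Aut}_\sigma(G)|}.$$
   Context: Fix a prime $p>2$ and a group $\{1,\sigma\}$ of order $2$. All homomorphisms of pro-$p$-groups are continuous, all subgroups are closed, and ''generated'' means topologically generated. A $\sigma$-pro-$p$-group is a pro-$p$-group $G$ with a continuous action of $\{1,\sigma\}$, written $a\mapsto{}^\sigma a$; $\sigma$-homomorphisms and $\sigma$-isomorphisms are the $\sigma$-equivariant ones, and $\mathrm{Aut}_\sigma(G)$ is the group of $\sigma$-equivariant automorphisms. Put $G^-:=\{a\in G\mid {}^\sigma a=a^{-1}\}$. Let $D_i(G)$ ($i\ge1$) be the Zassenhaus filtration (dimension subgroups mod $p$): $D_1(G)=G$, and $D_i(G)$ is generated by the $p$-th powers of elements of $D_{\lceil i/p\rceil}(G)$ and all $[D_j(G),D_k(G)]$ with $j+k=i$. $F_n$ is the free pro-$p$-group on $x_1,\dots,x_n$, made a $\sigma$-pro-$p$-group by ${}^\sigma x_i=x_i^{-1}$. For $r=(r_1,\dots,r_n)\in(F_n^-)^n$ let $N_r$ be the normal subgroup of $F_n$ generated by all conjugates of $r_1,\dots,r_n$, and $G_r:=F_n/N_r$. A weak Schur $\sigma$-group is a $\sigma$-pro-$p$-group $\sigma$-isomorphic to some $G_r$ with $n\ge0$, $r\in(F_n^-)^n$. $\mathrm{Sch}$ is the set of $\sigma$-isomorphism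 classes $[G]$ of weak Schur $\sigma$-groups, with the topology having as basis the sets $U_{i,G}:=\{[H]\in\mathrm{Sch}\mid H/D_i(H)\cong G/D_i(G)\ \sigma\text{-isomorphic}\}$ for all $i\ge2$ and all weak Schur $\sigma$-groups $G$. The Haar measure on $F_n^-$ is the unique Borel probability measure such that for every $\sigma$-invariant open normal subgroup $N\triangleleft F_n$ every fiber of the (surjective) map $F_n^-\to(F_n/N)^-$ has measure $1/|(F_n/N)^-|$. Let $\tilde\mu_n$ be the product measure on $(F_n^-)^n$, and $\mu_n$ its pushforward under the continuous map $(F_n^-)^n\to\mathrm{Sch}$, $r\mapsto[G_r]$. The probability measure $\mu_\infty$ on $\mathrm{Sch}$ is the limit $\mu_\infty(A)=\lim_{n\to\infty}\mu_n(A)$ for all Borel $A\subset\mathrm{Sch}$ (which exists). Put $C_\infty:=\prod_{i=1}^\infty(1-p^{-i})$. *)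

(* Defs.v *)
From HB Require Import structures.
From mathcomp Require Import all_boot all_order all_algebra finmap.
From mathcomp Require Import zify.
From mathcomp Require Import all_classical all_reals all_analysis.

Set Implicit Arguments.
Unset Strict Implicit.
Unset Printing Implicit Defensive.

Import Order.TTheory GRing.Theory Num.Theory.
Import numFieldNormedType.Exports.

Local Open Scope classical_set_scope.
Local Open Scope quotient_scope.
Local Open Scope group_scope.

HB.mixin Record isTopologicalGroup G of Group G & Topological G := {
  mulg_continuous : continuous (fun xy : G * G => xy.1 * xy.2);
  invg_continuous : continuous (fun x : G => x^-1)
}.

#[short(type="topGroupType")]
HB.structure Definition TopGroup :=
  {G of Group G & Topological G & isTopologicalGroup G}.

(* A topological group with a continuous action of the group {1, sigma} of
   order 2 by group automorphisms. *)
HB.mixin Record hasSigma G of TopGroup G := {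
  sigma : G -> G;
  sigmaK : involutive sigma;
  sigmaM : {morph sigma : x y / x * y};
  sigma_continuous : continuous sigma
}.

#[short(type="sigmaGroupType")]
HB.structure Definition SigmaGroup := {G of TopGroup G & hasSigma G}.

Section Subgroups.
Variable G : topGroupType.
Implicit Types (A H N : set G).

Definition subgroup_set H :=
  [/\ H 1, forall x y, H x -> H y -> H (x * y) & forall x, H x -> H x^-1].

Definition normal_set N :=
  subgroup_set N /\ forall x g, N x -> N (x ^ g).

Definition lcosets N : set (set G) := range (fun x => [set x * y | y in N]).

Definition closed_gen A : set G :=
  smallest [set H | closed H /\ subgroup_set H] A.

Lemma closed_gen_subgroup A : subgroup_set (closed_gen A).
Proof.
split=> [H [[_ []]] //|x y Ax Ay H HH|x Ax H HH].
- by case: (HH) => -[_ [_ HM _]] _; apply: HM; [exact: Ax|exact: Ay].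
- by case: (HH) => -[_ [_ _ HV]] _; apply: HV; exact: Ax.
Qed.

Lemma closed_gen_closed A : closed (closed_gen A).
Proof. by apply: closed_bigI => H [[]]. Qed.

Lemma sub_closed_gen A : A `<=` closed_gen A.
Proof. by move=> x Ax H [_]; exact. Qed.

End Subgroups.

Lemma closed_gen_map (G H : topGroupType) (A : set G) (B : set H) (f : G -> H) :
    continuous f -> {morph f : x y / x * y} ->
    (forall x, A x -> closed_gen B (f x)) ->
  forall x, closed_gen A x -> closed_gen B (f x).
Proof.
move=> fc fM fA x Ax K [[Kc Kg] BK].
have f1 : f 1 = 1 by apply: (mulgI (f 1)); rewrite -fM !mulg1.
have fV y : f y^-1 = (f y)^-1.
  by apply: (mulgI (f y)); rewrite -fM !mulgV f1.
case: (Kg) => K1 KM KV.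
apply: (Ax (f @^-1` K)); split; last by move=> y /fA; apply; split.
split; first by apply: preimage_closed => // y _; exact: fc.
by split=> [|y z|y] /=; rewrite /= ?f1 ?fM ?fV //; [exact: KM|exact: KV].
Qed.

Section NormalClosure.
Variable G : topGroupType.
Implicit Type A : set G.

Lemma conjg_continuous (g : G) : continuous (fun x => x ^ g).
Proof.
have mc (a b : G -> G) : continuous a -> continuous b ->
    continuous (fun x => a x * b x).
  move=> ac bc x.
  apply: (@continuous_comp _ _ _ (fun x => (a x, b x)) (fun xy => xy.1 * xy.2)).
    by apply: cvg_pair; [exact: ac|exact: bc].
  exact: mulg_continuous.
have cc (h : G) : continuous (fun _ : G => h) by move=> ?; exact: cvg_cst.
apply: (mc) => //; apply: (mc) => // x; exact: cvg_id.
Qed.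

Lemma closed_gen_normal A :
  (forall x g, A x -> A (x ^ g)) -> normal_set (closed_gen A).
Proof.
move=> AJ; split=> [|x g]; first exact: closed_gen_subgroup.
apply: (@closed_gen_map G G A A (fun x => x ^ g)).
- exact: conjg_continuous.
- by move=> y z; rewrite conjMg.
- by move=> y Ay; apply: sub_closed_gen; exact: AJ.
Qed.

End NormalClosure.

Lemma sigma1 (G : sigmaGroupType) : sigma (1 : G) = 1.
Proof. by apply: (mulgI (sigma 1)); rewrite -sigmaM !mulg1. Qed.

Lemma sigmaV (G : sigmaGroupType) (x : G) : sigma x^-1 = (sigma x)^-1.
Proof. by apply: (mulgI (sigma x)); rewrite -sigmaM !mulgV sigma1. Qed.

Record sigmaNormal (G : sigmaGroupType) := SigmaNormal {
  normal_carrier :> set G;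
  normal_carrierP : normal_set normal_carrier;
  normal_carrier_sigma : forall x, normal_carrier x -> normal_carrier (sigma x)
}.

Section Quotient.
Variables (G : sigmaGroupType) (N : sigmaNormal G).

Local Notation inN := (normal_carrier N).

Let N1 : inN 1. Proof. by case: (normal_carrierP N) => -[]. Qed.
Let NM x y : inN x -> inN y -> inN (x * y).
Proof. by case: (normal_carrierP N) => -[_ + _] _; exact. Qed.
Let NV x : inN x -> inN x^-1.
Proof. by case: (normal_carrierP N) => -[_ _ +] _; exact. Qed.
Let NJ x g : inN x -> inN (x ^ g).
Proof. by case: (normal_carrierP N) => _; exact. Qed.

Definition same_coset (x y : G) : bool := `[< inN (x^-1 * y) >].

Lemma same_coset_refl : reflexive same_coset.
Proof. by move=> x; apply/asboolP; rewrite mulVg. Qed.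

Lemma same_coset_sym : symmetric same_coset.
Proof.
move=> x y; apply/idP/idP => /asboolP /NV; rewrite invgM invgK => h; exact/asboolP.
Qed.

Lemma same_coset_trans : transitive same_coset.
Proof.
move=> y x z /asboolP xy /asboolP yz; apply/asboolP.
by have := NM xy yz; rewrite !mulgA mulgK.
Qed.

Canonical same_coset_equiv :=
  EquivRel same_coset same_coset_refl same_coset_sym same_coset_trans.

Definition quot : Type := quotient_topology {eq_quot same_coset}.

HB.instance Definition _ := Topological.on quot.
HB.instance Definition _ := Quotient.on quot.

Local Notation pi := (\pi_quot : G -> quot).

Lemma pi_eq (x y : G) : pi x = pi y <-> inN (x^-1 * y).
Proof.
have e : reflect (pi x = pi y) (same_coset x y) := @eqmodP _ same_coset_equiv x y.
by split=> [/e /asboolP //|h]; apply/e/asboolP.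
Qed.

Lemma repr_pi (x : G) : inN (x^-1 * repr (pi x)).
Proof. by apply/pi_eq; rewrite reprK. Qed.

Definition quot_mul (a b : quot) : quot := pi (repr a * repr b).
Definition quot_inv (a : quot) : quot := pi (repr a)^-1.
Definition quot_sigma (a : quot) : quot := pi (sigma (repr a)).

Lemma quot_piM x y : quot_mul (pi x) (pi y) = pi (x * y).
Proof.
apply/esym/pi_eq; have := NM (NJ y (repr_pi x)) (repr_pi y).
by rewrite /conjg invgM !mulgA mulgK.
Qed.

Lemma quot_piV x : quot_inv (pi x) = pi x^-1.
Proof.
apply/esym/pi_eq; have := NJ x^-1 (NV (repr_pi x)).
by rewrite /conjg invgM !invgK !mulgA mulgK.
Qed.

Lemma quot_pi_sigma x : quot_sigma (pi x) = pi (sigma x).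
Proof.
apply/esym/pi_eq; have := normal_carrier_sigma (repr_pi x).
by rewrite sigmaM sigmaV.
Qed.

Lemma pi_surj (a : quot) : exists x, a = pi x.
Proof. by exists (repr a); rewrite reprK. Qed.

Lemma quot_mulA : associative quot_mul.
Proof.
move=> a b c; have [x ->] := pi_surj a; have [y ->] := pi_surj b.
by have [z ->] := pi_surj c; rewrite !quot_piM mulgA.
Qed.

Lemma quot_mul1 : left_id (pi 1) quot_mul.
Proof. by move=> a; have [x ->] := pi_surj a; rewrite quot_piM mul1g. Qed.

Lemma quot_1mul : right_id (pi 1) quot_mul.
Proof. by move=> a; have [x ->] := pi_surj a; rewrite quot_piM mulg1. Qed.

Lemma quot_mulV : left_inverse (pi 1) quot_inv quot_mul.
Proof. by move=> a; have [x ->] := pi_surj a; rewrite quot_piV quot_piM mulVg. Qed.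

Lemma quot_Vmul : right_inverse (pi 1) quot_inv quot_mul.
Proof. by move=> a; have [x ->] := pi_surj a; rewrite quot_piV quot_piM mulgV. Qed.

HB.instance Definition _ := isGroup.Build quot
  quot_mulA quot_mul1 quot_1mul quot_mulV quot_Vmul.

Lemma quot_pi_continuous : continuous pi.
Proof. exact: pi_continuous. Qed.

Lemma mulgr_continuous (g : G) : continuous (fun x : G => x * g).
Proof.
move=> x; apply: (@continuous_comp _ _ _ (fun x => (x, g)) (fun xy => xy.1 * xy.2)).
  by apply: cvg_pair; [exact: cvg_id|exact: cvg_cst].
exact: mulg_continuous.
Qed.

Lemma quot_pi_nbhs (x : G) (P : set G) : nbhs x P -> nbhs (pi x) (pi @` P).
Proof.
rewrite nbhsE => -[U [oU Ux] UP]; rewrite nbhsE.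
exists (pi @` U); last by move=> _ [u Uu <-]; exists u => //; exact: UP.
split; last by exists x.
have -> : pi @` U = [set a | exists2 u, U u & pi u = a] by [].
suff : open (pi @^-1` (pi @` U)) by [].
have -> : pi @^-1` (pi @` U) = \bigcup_(n in inN) ((fun y => y * n) @^-1` U).
  apply/seteqP; split=> y /=.
    move=> [u Uu /esym/pi_eq Nyu]; exists (y^-1 * u) => //=.
    by rewrite mulgA mulgV mul1g.
  move=> [n Nn Uyn]; exists (y * n) => //; apply/esym/pi_eq.
  by rewrite mulgA mulVg mul1g.
by apply: bigcup_open => n _; apply: open_comp => // ? _; exact: mulgr_continuous.
Qed.

Lemma quot_mulg_continuous : continuous (fun ab : quot * quot => ab.1 * ab.2).
Proof.
move=> [a b]; have [x ->] := pi_surj a; have [y ->] := pi_surj b.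
move=> W; rewrite /= => nW.
have c : {for (x, y), continuous (pi \o (fun xy : G * G => xy.1 * xy.2))}.
  by apply: continuous_comp; [exact: mulg_continuous|exact: quot_pi_continuous].
have nW' : nbhs (pi (x * y)) W by rewrite -quot_piM.
case: (c W nW') => -[P Q] /= [nP nQ] PQ.
exists (pi @` P, pi @` Q); first by split; exact: quot_pi_nbhs.
move=> [_ _] /= [[u Pu <-] [v Qv <-]].
by have -> : pi u * pi v = pi (u * v) := quot_piM u v; apply: (PQ (u, v)).
Qed.

Lemma quot_invg_continuous : continuous (fun a : quot => a^-1).
Proof.
apply/quotient_continuous => x.
have -> : (fun a : quot => a^-1) \o pi = pi \o (fun x : G => x^-1).
  by apply/funext => y; exact: quot_piV.
apply: continuous_comp; first exact: invg_continuous.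
exact: quot_pi_continuous.
Qed.

HB.instance Definition _ :=
  isTopologicalGroup.Build quot quot_mulg_continuous quot_invg_continuous.

Lemma quot_sigmaK : involutive quot_sigma.
Proof.
by move=> a; have [x ->] := pi_surj a; rewrite !quot_pi_sigma sigmaK.
Qed.

Lemma quot_sigmaM : {morph quot_sigma : a b / a * b}.
Proof.
move=> a b; have [x ->] := pi_surj a; have [y ->] := pi_surj b.
rewrite [pi x * pi y]quot_piM !quot_pi_sigma sigmaM.
by rewrite [RHS]quot_piM.
Qed.

Lemma quot_sigma_continuous : continuous quot_sigma.
Proof.
apply/quotient_continuous => x.
have -> : quot_sigma \o pi = pi \o (@sigma G).
  by apply/funext => y; exact: quot_pi_sigma.
apply: continuous_comp; first exact: sigma_continuous.
exact: quot_pi_continuous.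
Qed.

HB.instance Definition _ :=
  hasSigma.Build quot quot_sigmaK quot_sigmaM quot_sigma_continuous.

Definition quot_pi : G -> quot := pi.

End Quotient.

Section ProP.
Variable p : nat.

Definition pro_p (G : topGroupType) : Prop :=
  [/\ compact [set: G], hausdorff_space G,
      (forall U : set G, nbhs (1 : G) U ->
         exists N, [/\ open N, normal_set N & N `<=` U]) &
      (forall N : set G, open N -> normal_set N ->
         exists k, (lcosets N #= `I_(p ^ k))%card)].

Definition free_pro_p (G : topGroupType) (n : nat) (x : 'I_n -> G) : Prop :=
  pro_p G /\
  forall (H : topGroupType) (y : 'I_n -> H), pro_p H ->
    exists! f : G -> H,
      [/\ continuous f, {morph f : a b / a * b} & forall i, f (x i) = y i].

Lemma pro_p_quot (G : sigmaGroupType) (N : sigmaNormal G) :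
  closed (normal_carrier N) -> pro_p G -> pro_p (quot N).
Proof.
pose inN := normal_carrier N.
pose pi : G -> quot N := quot_pi N.
have piC : continuous pi by exact: quot_pi_continuous.
have piM x y : pi (x * y) = pi x * pi y by rewrite [RHS]quot_piM.
have piV x : pi x^-1 = (pi x)^-1 by rewrite [RHS]quot_piV.
move=> Ncl [Gc Gh Gb Gi]; split.
- have -> : [set: quot N] = pi @` setT.
    by apply/seteqP; split=> a // _; have [x ->] := pi_surj a; exists x.
  by apply: continuous_compact => //; exact: continuous_subspaceT.
- move=> a b; have [x ->] := pi_surj a; have [y ->] := pi_surj b => cl.
  apply/pi_eq; apply: contrapT => nN.
  have : nbhs (x^-1 * y) (~` inN).
    by apply: open_nbhs_nbhs; split => //; exact: closed_openC.
  have ci : {for (x, y), continuous (fun xy : G * G => xy.1^-1)}.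
    apply: (@continuous_comp _ _ _ fst (fun x : G => x^-1)); first exact: cvg_fst.
    exact: invg_continuous.
  have c : {for (x, y), continuous (fun xy : G * G => xy.1^-1 * xy.2)}.
    apply: (@continuous_comp _ _ _ (fun xy : G * G => (xy.1^-1, xy.2))
      (fun xy : G * G => xy.1 * xy.2)); last exact: mulg_continuous.
    apply: cvg_pair; last exact: cvg_snd.
    exact: ci.
  move=> /c [[P Q] /= [nP nQ] PQ].
  have [_ [[u Pu <-] [v Qv /esym/pi_eq]]] := cl _ _ (quot_pi_nbhs N nP) (quot_pi_nbhs N nQ).
  by apply: (PQ (u, v)).
- move=> U nU.
  have /Gb [M [Mo [[M1 MM MV] MJ] MU]] : nbhs (1 : G) (pi @^-1` U) by exact: piC.
  exists (pi @` M); split; last by move=> _ [x /MU Ux <-].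
    rewrite openE => _ [x Mx <-]; apply: quot_pi_nbhs.
    by apply: open_nbhs_nbhs.
  split; first split; first by exists 1.
  + move=> _ _ [x Mx <-] [y My <-]; exists (x * y); [exact: MM|exact: piM].
  + move=> _ [x Mx <-]; exists x^-1; [exact: MV|exact: piV].
  + move=> _ g [x Mx <-]; have [y ->] := pi_surj g.
    by exists (x ^ y); [exact: MJ|rewrite /conjg !piM piV].
- move=> M Mo [[M1 MM MV] MJ].
  have [||k ck] := Gi (pi @^-1` M).
  + by apply: open_comp => // x _; exact: piC.
  + split; first split=> /=.
    * exact: M1.
    * by move=> x y Mx My; rewrite piM; exact: MM.
    * by move=> x Mx; rewrite piV; exact: MV.
    * by move=> x g Mx; rewrite /= /conjg !piM piV; exact: MJ.
  exists k; apply: card_eq_trans ck; rewrite card_eq_sym.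
  have im x : pi @` [set x * y | y in pi @^-1` M] = [set pi x * m | m in M].
    apply/seteqP; split=> [_ [_ [y My <-] <-]|_ [m Mm <-]].
      by exists (pi y) => //; rewrite piM.
    have [y ym] := pi_surj m; rewrite ym in Mm *.
    by exists (x * y); [exists y|exact: piM].
  have -> : lcosets M = (fun C : set G => pi @` C) @` lcosets (pi @^-1` M).
    apply/seteqP; split=> [_ [a _ <-]|_ [_ [x _ <-] <-]].
      have [x ->] := pi_surj a.
      by exists [set x * y | y in pi @^-1` M]; [exists x|exact: im].
    by exists (pi x) => //; rewrite im.
  rewrite card_eq_sym; apply: inj_card_eq => A B /set_mem[x _ <-] /set_mem[y _ <-].
  rewrite !im => e.
  have h z w : [set pi z * m | m in M] = [set pi w * m | m in M] ->
      [set z * m | m in pi @^-1` M] `<=` [set w * m | m in pi @^-1` M].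
    move=> zw _ [m Mm <-]; exists (w^-1 * (z * m)) => /=; last first.
      by rewrite mulgA mulgV mul1g.
    have : [set pi w * m | m in M] (pi z * pi m) by rewrite -zw; exists (pi m).
    by rewrite !piM piV => -[m' Mm' <-]; rewrite mulgA mulVg mul1g.
  by apply/seteqP; split; exact: h.
Qed.

End ProP.

Definition minus_part (G : sigmaGroupType) : set G := [set a | sigma a = a^-1].

Arguments minus_part : clear implicits.

Definition is_sigma_iso (G H : sigmaGroupType) (f : G -> H) : Prop :=
  [/\ continuous f, {morph f : x y / x * y}, {morph f : x / sigma x} &
      exists g : H -> G, [/\ continuous g, cancel f g & cancel g f]].

Definition sigma_isomorphic (G H : sigmaGroupType) : Prop :=
  exists f : G -> H, is_sigma_iso f.

Definition Aut_sigma (G : sigmaGroupType) : set (G -> G) :=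
  [set f | is_sigma_iso f].

Arguments Aut_sigma : clear implicits.

Lemma sigma_isomorphic_refl (G : sigmaGroupType) : sigma_isomorphic G G.
Proof.
by exists idfun; split=> // [x|]; [exact: cvg_id|];
  exists idfun; split=> // x; exact: cvg_id.
Qed.

Lemma sigma_isomorphic_sym (G H : sigmaGroupType) :
  sigma_isomorphic G H -> sigma_isomorphic H G.
Proof.
move=> [f [fc fM fs [g [gc fg gf]]]]; exists g; split=> //; last by exists f.
- by move=> x y; rewrite -[x in LHS]gf -[y in LHS]gf -fM fg.
- by move=> x; rewrite -[x in LHS]gf -fs fg.
Qed.

Lemma sigma_isomorphic_trans (G H K : sigmaGroupType) :
  sigma_isomorphic G H -> sigma_isomorphic H K -> sigma_isomorphic G K.
Proof.
move=> [f [fc fM fs [g [gc fg gf]]]] [f' [fc' fM' fs' [g' [gc' fg' gf']]]].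
exists (f' \o f); split.
- by move=> x; apply: continuous_comp; [exact: fc|exact: fc'].
- by move=> x y /=; rewrite fM fM'.
- by move=> x /=; rewrite fs fs'.
- exists (g \o g'); split.
  + by move=> x; apply: continuous_comp; [exact: gc'|exact: gc].
  + by move=> x /=; rewrite fg' fg.
  + by move=> x /=; rewrite gf gf'.
Qed.

Section Zassenhaus.
Variable p : nat.

(* Recursion on the fuel [k]; [zassenhausE] below shows that the fuel [i] used
   in [zassenhaus] is enough. *)
Fixpoint zassenhaus_rec (G : topGroupType) (k i : nat) : set G :=
  if k isn't k'.+1 then setT else if (i <= 1)%N then setT else
  closed_gen
    ([set x ^+ p | x in zassenhaus_rec k' ((i + p.-1) %/ p)%N] `|`
     [set z | exists j l x y,
        [/\ (0 < j)%N && (0 < l)%N, (j + l)%N = i,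
            zassenhaus_rec k' j x, zassenhaus_rec k' l y & z = [~ x, y]]]).

Arguments zassenhaus_rec : clear implicits.

Definition zassenhaus (G : topGroupType) (i : nat) : set G :=
  zassenhaus_rec G i i.

Arguments zassenhaus : clear implicits.

Lemma zassenhaus_rec_map (G H : topGroupType) (f : G -> H) :
    continuous f -> {morph f : x y / x * y} ->
  forall k i x, zassenhaus_rec G k i x -> zassenhaus_rec H k i (f x).
Proof.
move=> fc fM.
have f1 : f 1 = 1 by apply: (mulgI (f 1)); rewrite -fM !mulg1.
have fV y : f y^-1 = (f y)^-1 by apply: (mulgI (f y)); rewrite -fM !mulgV f1.
have fX y n : f (y ^+ n) = f y ^+ n.
  by elim: n => [|n IH]; rewrite ?expg0 // !expgS fM IH.
elim=> [//|k IH] i x /=; case: ifP => // _.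
apply: closed_gen_map => // {}x [[y Dy <-]|[j [l [y [z [jl e Dy Dz ->]]]]]];
  apply: sub_closed_gen.
  by left; exists (f y); [exact: IH|rewrite fX].
right; exists j, l, (f y), (f z); split => //; [exact: IH|exact: IH|].
by rewrite /commg /conjg !fM !fV.
Qed.

Lemma zassenhaus_normal (G : topGroupType) i : normal_set (zassenhaus G i).
Proof.
split; last first.
  move=> x g; apply: (@zassenhaus_rec_map G G (fun x => x ^ g)).
    exact: conjg_continuous.
  by move=> y z; rewrite conjMg.
rewrite /zassenhaus; case: {1}i => [|k] /=; first by split.
by case: ifP => _; [split|exact: closed_gen_subgroup].
Qed.

Lemma zassenhaus_sigma (G : sigmaGroupType) i (x : G) :
  zassenhaus G i x -> zassenhaus G i (sigma x).
Proof.
by apply: zassenhaus_rec_map; [exact: sigma_continuous|exact: sigmaM].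
Qed.

Definition zassenhausN (G : sigmaGroupType) (i : nat) : sigmaNormal G :=
  SigmaNormal (zassenhaus_normal G i) (@zassenhaus_sigma G i).

Hypothesis p_neq1 : p != 1%N.

Lemma ceil_lt i : (1 < i)%N -> ((i + p.-1) %/ p < i)%N.
Proof.
case: p p_neq1 => [|[|q]] // _ i1; first by rewrite divn0; exact: ltnW.
by rewrite ltn_divLR //= mulnS; nia.
Qed.

Lemma zassenhaus_recE (G : topGroupType) k k' i : (i <= k)%N -> (i <= k')%N ->
  zassenhaus_rec G k i = zassenhaus_rec G k' i.
Proof.
elim: k k' i => [|k IH] [|k'] [|i] //= ik ik'; case: ifP => // /negbT.
rewrite -ltnNge => i1.
have e j : (j < i.+1)%N -> zassenhaus_rec G k j = zassenhaus_rec G k' j.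
  by rewrite ltnS => ji; apply: IH; exact: (leq_trans ji).
rewrite e; last exact: ceil_lt.
congr (closed_gen (_ `|` _)); apply/seteqP; split=> z [j [l [x [y]]]];
  move=> [/andP[j0 l0] jl Dx Dy ->]; exists j, l, x, y; split=> //;
  rewrite ?j0 ?l0 // ?e // -?e //; lia.
Qed.

Lemma zassenhaus1 (G : topGroupType) : zassenhaus G 1 = setT.
Proof. by []. Qed.

Lemma zassenhausE (G : topGroupType) i : (1 < i)%N ->
  zassenhaus G i = closed_gen
    ([set x ^+ p | x in zassenhaus G ((i + p.-1) %/ p)%N] `|`
     [set z | exists j l x y,
        [/\ (0 < j)%N && (0 < l)%N, (j + l)%N = i,
            zassenhaus G j x, zassenhaus G l y & z = [~ x, y]]]).
Proof.
move=> i1; rewrite [LHS](@zassenhaus_recE G i i.+1) //= leqNgt i1 /=.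
rewrite [zassenhaus_rec G i _](@zassenhaus_recE G _ ((i + p.-1) %/ p)%N) //; last exact/ltnW/ceil_lt.
congr (closed_gen (_ `|` _)); apply/seteqP; split=> z [j [l [x [y]]]];
  move=> [jl0 jl Dx Dy ->]; exists j, l, x, y; split=> //.
- by rewrite /zassenhaus (@zassenhaus_recE G _ i) //; lia.
- by rewrite /zassenhaus (@zassenhaus_recE G _ i) //; lia.
- by rewrite (@zassenhaus_recE G _ j) //; lia.
- by rewrite (@zassenhaus_recE G _ l) //; lia.
Qed.

Lemma zassenhaus_closed (G : topGroupType) i : closed (zassenhaus G i).
Proof.
have [i1|i1] := leqP i 1.
  by case: i i1 => [|[|]] // _; exact: closedT.
by rewrite zassenhausE //; exact: closed_gen_closed.
Qed.

Lemma zassenhausS (G : topGroupType) i : zassenhaus G i.+1 `<=` zassenhaus G i.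
Proof.
elim/ltn_ind: i => i IH.
have [i1|i1] := leqP i 1; first by case: i i1 IH => [|[|]].
rewrite [X in X `<=` _]zassenhausE ?[X in _ `<=` X]zassenhausE //; last exact: ltnW.
apply: smallest_sub.
  split; [by exact: closed_gen_closed|exact: closed_gen_subgroup].
move=> _ [[x Dx <-]|[j [l [x [y [/andP[j0 l0] jl Dx Dy ->]]]]]];
  apply: sub_closed_gen.
- left; exists x => //.
  have [e|e] : ((i.+1 + p.-1) %/ p = (i + p.-1) %/ p \/
     (i.+1 + p.-1) %/ p = ((i + p.-1) %/ p).+1)%N.
    have [p0|p_gt0] := posnP p; first by left; rewrite p0 !divn0.
    have := divn_eq (i.+1 + p.-1) p; have := divn_eq (i + p.-1) p.
    have := ltn_pmod (i + p.-1) p_gt0.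
    have := ltn_pmod (i.+1 + p.-1) p_gt0.
    set a := ((i.+1 + p.-1) %/ p)%N; set b := ((i + p.-1) %/ p)%N.
    by clear -p_gt0; nia.
  + by rewrite -e.
  + by apply: IH; [exact: ceil_lt|rewrite -e].
- right; have [l1|l1] := leqP l 1.
    exists j.-1, l, x, y; split=> //; try lia.
    by apply: IH; [lia|rewrite prednK].
  exists j, l.-1, x, y; split=> //; try lia.
  by apply: IH; [lia|rewrite prednK].
Qed.

Lemma zassenhaus_sub (G : topGroupType) i m :
  (i <= m)%N -> zassenhaus G m `<=` zassenhaus G i.
Proof.
move=> /subnK <-; elim: (m - i)%N => [//|d IH].
by apply: subset_trans IH; rewrite addSn; exact: zassenhausS.
Qed.

End Zassenhaus.

Arguments zassenhaus_rec : clear implicits.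
Arguments zassenhaus : clear implicits.

Lemma zassenhaus_quot_iso (p : nat) (G H : sigmaGroupType) (i m : nat) :
    (i <= m)%N ->
    sigma_isomorphic (quot (zassenhausN p G m)) (quot (zassenhausN p H m)) ->
  sigma_isomorphic (quot (zassenhausN p G i)) (quot (zassenhausN p H i)).
Proof.
have [->|p1] := eqVneq p 1%N.
  have DT (K : sigmaGroupType) k (x : K) : zassenhaus 1 K k x.
    rewrite /zassenhaus; move: {1}k => l.
    elim: l k x => [//|l IH] k x /=; case: ifP => // k1.
    apply: sub_closed_gen; left; exists x; last by rewrite expg1.
    exact: IH.
  have triv (K : sigmaGroupType) (a b : quot (zassenhausN 1 K i)) : a = b.
    have [x ->] := pi_surj a; have [y ->] := pi_surj b; apply/pi_eq; exact: DT.
  move=> _ _; exists (fun _ => 1); split.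
  - exact: cst_continuous.
  - by move=> x y; exact: triv.
  - by move=> x; exact: triv.
  - exists (fun _ => 1); split=> [|x|x]; [exact: cst_continuous|exact: triv|exact: triv].
move: G H.
suff main (G H : sigmaGroupType) (im : (i <= m)%N)
    (f : quot (zassenhausN p G m) -> quot (zassenhausN p H m)) :
    is_sigma_iso f -> exists f' : quot (zassenhausN p G i) -> quot (zassenhausN p H i),
    [/\ continuous f', {morph f' : x y / x * y}, {morph f' : x / sigma x} &
       forall x, f' (quot_pi _ x) = quot_pi _ (repr (f (quot_pi _ x)))].
  move=> G H im [f fi]; case: (fi) => fc fM fs [g [gc fg gf]].
  have gi : is_sigma_iso g.
    split=> //; last by exists f.
    - by move=> x y; rewrite -[x in LHS]gf -[y in LHS]gf -fM fg.
    - by move=> x; rewrite -[x in LHS]gf -fs fg.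
  have [f' [fc' fM' fs' fE]] := main _ _ im _ fi.
  have [g' [gc' _ _ gE]] := main _ _ im _ gi.
  exists f'; split=> //; exists g'; split=> // a; have [x ->] := pi_surj a.
    by rewrite -/(quot_pi _ x) fE gE /quot_pi reprK fg; apply/esym/pi_eq;
      exact: (zassenhaus_sub p1 im (@repr_pi _ (zassenhausN p G m) x)).
  by rewrite -/(quot_pi _ x) gE fE /quot_pi reprK gf; apply/esym/pi_eq;
    exact: (zassenhaus_sub p1 im (@repr_pi _ (zassenhausN p H m) x)).
move=> [fc fM fs _].
pose piG := quot_pi (zassenhausN p G m); pose piH := quot_pi (zassenhausN p H m).
have piHM x y : piH (x * y) = piH x * piH y by rewrite [RHS]quot_piM.
have piHV x : piH x^-1 = (piH x)^-1 by rewrite [RHS]quot_piV.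
have piGM x y : piG (x * y) = piG x * piG y by rewrite [RHS]quot_piM.
have piGs x : piG (sigma x) = sigma (piG x) by rewrite [RHS]quot_pi_sigma.
have piHs x : piH (sigma x) = sigma (piH x) by rewrite [RHS]quot_pi_sigma.
pose F x := f (piG x).
have Fc : continuous F.
  by move=> x; apply: continuous_comp; [exact: quot_pi_continuous|exact: fc].
have FM x y : F (x * y) = F x * F y by rewrite /F piGM fM.
have F1 : F 1 = 1 by apply: (mulgI (F 1)); rewrite -FM !mulg1.
have FV x : F x^-1 = (F x)^-1 by apply: (mulgI (F x)); rewrite -FM !mulgV F1.
have FX x n : F (x ^+ n) = F x ^+ n.
  by elim: n => [|n IH]; rewrite ?expg0 // !expgS FM IH.
have piH1 : piH 1 = 1 by apply: (mulgI (piH 1)); rewrite -piHM !mulg1.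
have piHX x n : piH (x ^+ n) = piH x ^+ n.
  by elim: n => [|n IH]; rewrite ?expg0 // !expgS piHM IH.
have subm j : (j <= m)%N -> zassenhaus p H m `<=` zassenhaus p H j.
  exact: zassenhaus_sub.
have preim j : (j <= m)%N ->
    piH @^-1` (piH @` zassenhaus p H j) = zassenhaus p H j.
  move=> jm; apply/seteqP; split=> [x [y Dy /pi_eq xy]|x Dx]; last by exists x.
  have [[_ DM _] _] := zassenhaus_normal p H j.
  by rewrite -[x](mul1g x) -(mulgV y) -mulgA; apply: DM => //; exact: subm xy.
have img j : (j <= m)%N -> forall x, zassenhaus p G j x ->
    (piH @` zassenhaus p H j) (F x).
  elim/ltn_ind: j => j IH jm.
  have [j1|j1] := leqP j 1.
    move=> x _; have [y ->] := pi_surj (F x); exists y => //.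
    by case: j j1 {IH jm} => [|[|]].
  have [[D1 DM DV] _] := zassenhaus_normal p H j.
  change (zassenhaus p G j `<=` F @^-1` (piH @` zassenhaus p H j)).
  rewrite zassenhausE //; apply: smallest_sub; first split.
  - apply: preimage_closed => [? _|]; first exact: Fc.
    suff o : open (piH @^-1` (~` (piH @` zassenhaus p H j))).
      by rewrite -openC; exact: o.
    have -> : piH @^-1` (~` (piH @` zassenhaus p H j)) = ~` zassenhaus p H j.
      by rewrite -[in RHS](preim j jm).
    by rewrite openC; exact: zassenhaus_closed.
  - split=> [|x y [u Du ux] [v Dv vy]|x [u Du ux]] /=.
    + by exists 1; rewrite ?F1.
    + by exists (u * v); [exact: DM|rewrite piHM FM ux vy].
    + by exists u^-1; [exact: DV|rewrite piHV FV ux].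
  - move=> _ [[x Dx <-]|[k [l [x [y [/andP[k0 l0] kl Dx Dy ->]]]]]] /=.
      have lt := ceil_lt p1 j1.
      have [u Du ux] := IH _ lt (leq_trans (ltnW lt) jm) _ Dx.
      exists (u ^+ p); last by rewrite piHX FX ux.
      by rewrite zassenhausE //; apply: sub_closed_gen; left; exists u.
    have kj : (k < j)%N by lia.
    have lj : (l < j)%N by lia.
    have [u Du ux] := IH _ kj (leq_trans (ltnW kj) jm) _ Dx.
    have [v Dv vy] := IH _ lj (leq_trans (ltnW lj) jm) _ Dy.
    exists [~ u, v].
      rewrite zassenhausE //; apply: sub_closed_gen; right.
      by exists k, l, u, v; rewrite k0 l0.
    by rewrite /commg /conjg !(piHM, piHV, FM, FV) ux vy.
pose qH := quot_pi (zassenhausN p H i); pose qG := quot_pi (zassenhausN p G i).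
have qrepr x : qH (repr (piH x)) = qH x.
  by apply/esym/pi_eq; exact: (subm _ im _ (@repr_pi _ (zassenhausN p H m) x)).
pose K x := qH (repr (F x)).
have KE x u : F x = piH u -> K x = qH u by move=> e; rewrite /K e qrepr.
have qHM x y : qH (x * y) = qH x * qH y by rewrite [RHS]quot_piM.
have qGM x y : qG (x * y) = qG x * qG y by rewrite [RHS]quot_piM.
have qHs x : qH (sigma x) = sigma (qH x) by rewrite [RHS]quot_pi_sigma.
have qGs x : qG (sigma x) = sigma (qG x) by rewrite [RHS]quot_pi_sigma.
have KM x y : K (x * y) = K x * K y.
  have [u xu] := pi_surj (F x); have [v yv] := pi_surj (F y).
  by rewrite (KE _ _ xu) (KE _ _ yv) -qHM; apply: KE; rewrite FM xu yv piHM.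
have Ks x : K (sigma x) = sigma (K x).
  have [u xu] := pi_surj (F x).
  by rewrite (KE _ _ xu) -qHs; apply: KE; rewrite /F piGs fs -/(F x) xu piHs.
have K1 x : zassenhaus p G i x -> K x = 1.
  move=> /(img _ im) [u Du ux]; rewrite (KE x u) //.
  have -> : (1 : quot (zassenhausN p H i)) = qH 1 by [].
  apply/pi_eq; have [[_ DM DV] _] := zassenhaus_normal p H i.
  by rewrite mulg1; exact: DV.
have Kc : continuous K.
  have -> : K = (qH \o repr) \o F by [].
  move=> x; apply: continuous_comp; first exact: Fc.
  have : continuous ((qH \o repr) : quot (zassenhausN p H m) -> _).
    apply/quotient_continuous.
    have -> : (qH \o repr) \o \pi_(quot (zassenhausN p H m)) = qH.
      by apply/funext => y; exact: qrepr.
    exact: quot_pi_continuous.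
  exact.
have K1' : K 1 = 1 by apply: (mulgI (K 1)); rewrite -KM !mulg1.
have KV x : K x^-1 = (K x)^-1 by apply: (mulgI (K x)); rewrite -KM !mulgV K1'.
pose f' (a : quot (zassenhausN p G i)) := K (repr a).
have fE x : f' (qG x) = K x.
  have /K1 := @repr_pi _ (zassenhausN p G i) x.
  by rewrite KM KV => e; rewrite -[RHS]mulg1 -e mulgA mulgV mul1g.
exists f'; split=> //.
- apply/quotient_continuous.
  by have -> : f' \o \pi_(quot (zassenhausN p G i)) = K by apply/funext => x; exact: fE.
- move=> a b; have [x ->] := pi_surj a; have [y ->] := pi_surj b.
  by rewrite -/(qG x) -/(qG y) -qGM !fE KM.
- move=> a; have [x ->] := pi_surj a.
  by rewrite -/(qG x) -qGs !fE Ks.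
Qed.

Lemma zassenhaus_iso (p : nat) (G H : sigmaGroupType) (i : nat) :
    sigma_isomorphic G H ->
  sigma_isomorphic (quot (zassenhausN p G i)) (quot (zassenhausN p H i)).
Proof.
move=> [f [fc fM fs [g [gc fg gf]]]].
have gM : {morph g : x y / x * y}.
  by move=> x y; rewrite -[x in LHS]gf -[y in LHS]gf -fM fg.
have gs : {morph g : x / sigma x}.
  by move=> x; rewrite -[x in LHS]gf -fs fg.
pose q (K : sigmaGroupType) := quot_pi (zassenhausN p K i).
have main (K L : sigmaGroupType) (h : K -> L) : continuous h ->
    {morph h : x y / x * y} -> {morph h : x / sigma x} ->
    exists h' : quot (zassenhausN p K i) -> quot (zassenhausN p L i),
    [/\ continuous h', {morph h' : x y / x * y}, {morph h' : x / sigma x} &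
       forall x, h' (q K x) = q L (h x)].
  move=> hc hM hs.
  have h1 : h 1 = 1 by apply: (mulgI (h 1)); rewrite -hM !mulg1.
  have hV y : h y^-1 = (h y)^-1 by apply: (mulgI (h y)); rewrite -hM !mulgV h1.
  have qM (M : sigmaGroupType) x y : q M (x * y) = q M x * q M y.
    by rewrite [RHS]quot_piM.
  have qs (M : sigmaGroupType) x : q M (sigma x) = sigma (q M x).
    by rewrite [RHS]quot_pi_sigma.
  pose h' (a : quot (zassenhausN p K i)) := q L (h (repr a)).
  have hE x : h' (q K x) = q L (h x).
    apply/esym/pi_eq; rewrite -hV -hM.
    exact: (zassenhaus_rec_map hc hM (@repr_pi _ (zassenhausN p K i) x)).
  exists h'; split=> //.
  - apply/quotient_continuous.
    have -> : h' \o \pi_(quot (zassenhausN p K i)) = q L \o h.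
      by apply/funext => x; exact: hE.
    by move=> x; apply: continuous_comp; [exact: hc|exact: quot_pi_continuous].
  - move=> a b; have [x ->] := pi_surj a; have [y ->] := pi_surj b.
    by rewrite -/(q K x) -/(q K y) -qM !hE hM qM.
  - move=> a; have [x ->] := pi_surj a.
    by rewrite -/(q K x) -qs !hE hs qs.
have [f' [fc' fM' fs' fE]] := main _ _ f fc fM fs.
have [g' [gc' _ _ gE]] := main _ _ g gc gM gs.
exists f'; split=> //; exists g'; split=> // a; have [x ->] := pi_surj a.
  by rewrite -/(q G x) fE gE fg.
by rewrite -/(q H x) gE fE gf.
Qed.

Definition minus_type (G : sigmaGroupType) : Type := set_type (minus_part G).

HB.instance Definition _ (G : sigmaGroupType) :=
  Topological.on (minus_type G).

Lemma minus1 (G : sigmaGroupType) : minus_part G 1.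
Proof. by rewrite /minus_part /= sigma1 invg1. Qed.

HB.instance Definition _ (G : sigmaGroupType) :=
  isPointed.Build (minus_type G) (exist _ 1 (mem_set (minus1 G))).

Definition minus_borel (G : sigmaGroupType) :=
  g_sigma_algebraType (@open (minus_type G)).

HB.instance Definition _ (G : sigmaGroupType) := Measurable.on (minus_borel G).

Definition minus_val (G : sigmaGroupType) (a : minus_borel G) : G :=
  set_val (a : minus_type G).

Lemma minus_valP (G : sigmaGroupType) (a : minus_borel G) :
  minus_part G (minus_val a).
Proof. exact: set_valP. Qed.

Section Relators.
Variables (G : sigmaGroupType) (n : nat) (r : n.-tuple (minus_borel G)).

Definition relators : set G :=
  [set z | exists (i : 'I_n) (g : G), z = minus_val (tnth r i) ^ g].

Lemma relators_normal : normal_set (closed_gen relators).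
Proof.
apply: closed_gen_normal => _ h [i [g ->]].
by exists i, (g * h); rewrite conjgM.
Qed.

Lemma relators_sigma x :
  closed_gen relators x -> closed_gen relators (sigma x).
Proof.
apply: closed_gen_map; [exact: sigma_continuous|exact: sigmaM|].
move=> _ [i [g ->]]; have [_ _ DV] := closed_gen_subgroup relators.
have -> : sigma (minus_val (tnth r i) ^ g) =
    (minus_val (tnth r i) ^ sigma g)^-1.
  rewrite /conjg !sigmaM sigmaV (minus_valP (tnth r i)).
  by rewrite !invgM invgK mulgA.
by apply: DV; apply: sub_closed_gen; exists i, (sigma g).
Qed.

Definition relator_normal : sigmaNormal G :=
  SigmaNormal relators_normal relators_sigma.

End Relators.

(* The sigma-pro-p-groups F_n, n >= 0, with their free generators. *)
Record free_sigma_system (p : nat) := FreeSigmaSystem {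
  free_group :> nat -> sigmaGroupType;
  free_gen : forall n, 'I_n -> free_group n;
  free_groupP : forall n, free_pro_p p (@free_gen n);
  free_gen_sigma : forall n i, sigma (@free_gen n i) = (@free_gen n i)^-1
}.

Section Sch.
Variables (p : nat) (F : free_sigma_system p).

Definition presentation : Type := {n : nat & n.-tuple (minus_borel (F n))}.

Definition presented_group (w : presentation) : sigmaGroupType :=
  quot (relator_normal (projT2 w)).

Definition weak_schur (G : sigmaGroupType) : Prop :=
  pro_p p G /\ exists w, sigma_isomorphic G (presented_group w).

Lemma weak_schur_presented (w : presentation) : weak_schur (presented_group w).
Proof.
split; last by exists w; exact: sigma_isomorphic_refl.
by apply: pro_p_quot; [exact: closed_gen_closed|case: (free_groupP F (projT1 w))].
Qed.

(* Since sigma-groups form a large type, an isomorphism class [G] is represented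
   by the small set of all presentations of G. *)
Definition presentations (G : sigmaGroupType) : set presentation :=
  [set w | sigma_isomorphic G (presented_group w)].

Definition Sch : Type :=
  set_type [set C | exists2 G, weak_schur G & C = presentations G].

HB.instance Definition _ := Choice.on Sch.

Definition sch_class (G : sigmaGroupType) (hG : weak_schur G) : Sch :=
  exist _ (presentations G) (mem_set (ex_intro2 _ _ G hG erefl)).

Lemma sch_class_eq (G H : sigmaGroupType) (hG : weak_schur G) (hH : weak_schur H) :
  sch_class hG = sch_class hH <-> sigma_isomorphic G H.
Proof.
split=> [e|GH].
  have eqp : presentations G = presentations H := congr1 sval e.
  have [w Gw] := hG.2; apply: (sigma_isomorphic_trans (Gw)).
  apply: sigma_isomorphic_sym.
  by have : presentations G w := Gw; rewrite eqp.
apply: val_inj => /=.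
apply/seteqP; split=> w; rewrite /presentations /=.
  exact/sigma_isomorphic_trans/sigma_isomorphic_sym.
exact: sigma_isomorphic_trans.
Qed.

Lemma sch_classP (c : Sch) : exists G (hG : weak_schur G), c = sch_class hG.
Proof.
case: c => C hC; have [G hG eC] := set_mem hC.
by exists G, hG; apply: val_inj.
Qed.

Definition sch_basic (i : nat) (G : sigmaGroupType) : set Sch :=
  [set c | exists H (hH : weak_schur H), c = sch_class hH /\
     sigma_isomorphic (quot (zassenhausN p H i)) (quot (zassenhausN p G i))].

Definition sch_base : set (set Sch) :=
  [set U | exists i G, [/\ (2 <= i)%N, weak_schur G & U = sch_basic i G]].

Lemma sch_base_cover : \bigcup_(U in sch_base) U = setT.
Proof.
apply/seteqP; split=> // c _; have [G [hG ->]] := sch_classP c.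
exists (sch_basic 2 G); first by exists 2, G.
by exists G, hG; split=> //; exact: sigma_isomorphic_refl.
Qed.

Lemma sch_base_join (U V : set Sch) (c : Sch) :
    sch_base U -> sch_base V -> U c -> V c ->
  exists W, [/\ sch_base W, W c & W `<=` U `&` V].
Proof.
move=> [i [G [i2 hG ->]]] [j [H [j2 hH ->]]] [K [hK [-> KG]]] [K' [hK' [e KH]]].
have {e} /sch_class_eq KK' := e.
exists (sch_basic (maxn i j) K); split.
- by exists (maxn i j), K; rewrite leq_max i2.
- by exists K, hK; split=> //; exact: sigma_isomorphic_refl.
- move=> _ [L [hL [-> LK]]]; split.
  + exists L, hL; split=> //; apply: sigma_isomorphic_trans KG.
    by apply: zassenhaus_quot_iso LK; exact: leq_maxl.
  + exists L, hL; split=> //; apply: sigma_isomorphic_trans KH.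
    apply: (@sigma_isomorphic_trans _ (quot (zassenhausN p K j))).
      by apply: zassenhaus_quot_iso LK; exact: leq_maxr.
    exact: zassenhaus_iso.
Qed.

HB.instance Definition _ :=
  isBaseTopological.Build Sch sch_base_cover sch_base_join.

End Sch.

Section Measures.
Local Open Scope ring_scope.
Local Open Scope ereal_scope.
Variable R : realType.

(* The cardinality of a finite set (0 if the set is infinite). *)
Definition card_set (T : choiceType) (A : set T) : nat := #|` fset_set A|%fset.

(* The property characterizing the Haar measure on [minus_part G], for [G] a free
   sigma-pro-p-group F_n. *)
Definition is_haar (G : sigmaGroupType)
    (mu : probability (minus_borel G) R) : Prop :=
  forall N : sigmaNormal G, open (normal_carrier N) ->
  forall y : quot N, minus_part (quot N) y ->
    mu [set a | quot_pi N (minus_val a) = y] =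
    ((card_set (minus_part (quot N)))%:R^-1)%:E.

Section Power.
Variables (d : measure_display) (T : measurableType d) (P : probability T R).

Definition cons_pair n (x : T * n.-tuple T) : n.+1.-tuple T :=
  [tuple of x.1 :: x.2].

Lemma measurable_cons_pair n : measurable_fun setT (@cons_pair n).
Proof. exact: measurable_cons. Qed.

HB.instance Definition _ n := isMeasurableFun.Build _ _ _ _
  (@cons_pair n) (@measurable_cons_pair n).

Fixpoint power_measure n : probability (n.-tuple T) R :=
  if n is n'.+1 then
    distribution (P \x power_measure n') (@cons_pair n')
  else \d_ ([tuple] : 0.-tuple T).

Lemma measurable_box n (A : 'I_n -> set T) : (forall i, measurable (A i)) ->
  measurable [set t : n.-tuple T | forall i, A i (tnth t i)].
Proof.
move=> mA.
have -> : [set t : n.-tuple T | forall i, A i (tnth t i)] =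
    \big[setI/setT]_(i < n) ((@tnth n T ^~ i) @^-1` A i).
  rewrite -bigcap_seq; apply/seteqP; split=> t /= tA i => [_|]; first exact: tA.
  by apply: (tA i) => /=; rewrite mem_index_enum.
apply: bigsetI_measurable => i _.
by rewrite -[X in measurable X]setTI; exact: measurable_tnth.
Qed.

Lemma power_measureE n (A : 'I_n -> set T) : (forall i, measurable (A i)) ->
  power_measure n [set t | forall i, A i (tnth t i)] = \prod_(i < n) P (A i).
Proof.
elim: n A => [|n IH] A mA.
  by rewrite big_ord0 /= diracE mem_set //; case.
rewrite big_ord_recl -IH // /= /distribution /pushforward /=.
rewrite -product_measure1E //; last by apply: (@measurable_box n (fun i => A (lift ord0 i))).
congr (_ _); apply/seteqP; split=> -[x t] /=.
  move=> h; split; first by have := h ord0; rewrite tnth0.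
  by move=> i; have := h (lift ord0 i); rewrite tnthS.
move=> [A0 h] i; case: (unliftP ord0 i) => [k ->|->]; last by rewrite tnth0.
by rewrite tnthS; exact: h.
Qed.

End Power.
Section SchMeasure.
Variables (p : nat) (F : free_sigma_system p).

Definition trivial_presentation : presentation F := existT (fun n => n.-tuple (minus_borel (F n))) 0%N [tuple].

HB.instance Definition _ :=
  isPointed.Build (Sch F) (sch_class (weak_schur_presented trivial_presentation)).

Definition sch_borel := g_sigma_algebraType (@open (Sch F)).

HB.instance Definition _ := Measurable.on sch_borel.

Definition sch_of_relators n (r : n.-tuple (minus_borel (F n))) : sch_borel :=
  sch_class (weak_schur_presented (existT _ n r)).

Variable haar : forall n, probability (minus_borel (F n)) R.

Definition mu_n (n : nat) : set sch_borel -> \bar R :=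
  pushforward (power_measure (haar n) n) (@sch_of_relators n).

(* [limn] of a divergent sequence in [\bar R] is the default value [0], so an
   equation [mu_infty A = x] with [x != 0] includes the existence of the limit. *)
Definition mu_infty (A : set sch_borel) : \bar R := limn (fun n => mu_n n A).

End SchMeasure.

Definition C_infty (p : nat) : R :=
  limn (fun n : nat => (\prod_(1 <= i < n.+1) (1 - p%:R ^- i))%R : R).

End Measures.

(* Main.v *)
(* Let G = F_m / N_r0 and n >= m. If G_r is isomorphic to G then N_r is the kernel of a
   sigma-surjection F_n -> G; such surjections are the generating n-tuples in G^-, and
   Aut_sigma(G) permutes those with a given kernel simply transitively. For one kernel
   N put M = N^p [N, F_n] and V = N / M. By the Frattini argument in finite p-quotients,
   N_r = N iff the images of the relators lie in V and span it. A greedy choice of lifts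
   of the generators of G (Gaschuetz) shows that N is again normally generated by n
   elements of F_n^-, so sigma acts on V by inversion and dim V <= n; dim V >= n because
   F_n has too many homomorphisms to Z / p^s for N to need fewer generators. Hence
   |(F_n/M)^-| = |G^-| p^n and
     mu_n({[G]}) = (# generating tuples / |G^-|^n) prod_{i <= n} (1 - p^-i) / |Aut_sigma(G)|,
   where the first factor tends to 1. The point [G] is isolated because D_i(G) = 1 for
   some i, and D_i(H) = D_{pi}(H) forces D_i(H) = 1 in every pro-p group H. *)
Require Import Defs.
From HB Require Import structures.
From mathcomp Require Import all_boot all_order all_algebra all_fingroup all_solvable.

Set Implicit Arguments.
Unset Strict Implicit.
Unset Printing Implicit Defensive.

(** * Finite p-groups *)

(** A presentation of G has its own number m of generators, and nothing ties it to a given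
    surjection F_n -> G; yet the probability is needed for every such surjection. Gaschuetz lifting
    transports the presentation into F_n, giving each kernel as many relators as generators. Since
    F_n^- is not a subgroup, a lift w is altered only by symmetric moves t w t, with t in the kernel
    and in F_n^-; these produce fourth powers modulo the Frattini subgroup, and undoing them is
    where p > 2 enters. Equality of the two numbers makes spanning n-tuples of V bases, which
    explains the product of the p^n - p^i. The sum runs over generating tuples of G, not over
    kernels: the events of different tuples overlap, each r with G_r isomorphic to G lying in
    exactly |Aut_sigma(G)| of them, so no representatives of kernels are chosen. Free groups are
    given by their universal property alone. That the x_i generate F_n, and that F_n^- maps onto
    G^-, are therefore derived: the former from uniqueness of homomorphisms, the latter from
    positivity of the Haar measure of fibers. *)

Section FiniteGroups.
Local Open Scope group_scope.
Variable (gT : finGroupType).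
Implicit Types (A N P V : {group gT}).

(** Elements of ['Phi(N)] are non-generators, so N = A [N, P]. Modulo A this reads N / A =
    [N / A, P / A], which in the nilpotent group P / A leaves only the trivial subgroup. *)
Lemma pgroup_normal_frattini (p : nat) A N P : p.-group P -> A <| P -> N <| P ->
  A \subset N -> N \subset 'Phi(N) <*> (A <*> [~: N, P]) -> N \subset A.
Proof.
move=> pP nAP nNP sAN sN.
have sRN : [~: N, P] \subset N by rewrite commg_subl; case/andP: nNP.
have eN : A <*> [~: N, P] = N.
  rewrite -[LHS]genGid; apply: Phi_nongen; apply/eqP.
  by rewrite eqEsubset sN !join_subG Phi_sub sAN sRN.
have nAN := normal_norm nAP.
rewrite -quotient_sub1 ?subG1; last exact: subset_trans (normal_sub nNP) nAN.
have nilQ : nilpotent (P / A) by apply: pgroup_nil (quotient_pgroup A pP).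
move/forallP/(_ (N / A)%G)/implyP: nilQ; apply.
rewrite subsetI quotientS ?(normal_sub nNP) //= -quotientR //;
  last exact: subset_trans (normal_sub nNP) nAN.
rewrite -{1}eN quotientY; last 2 first.
- exact: normG.
- exact: subset_trans sRN (subset_trans (normal_sub nNP) nAN).
by rewrite trivg_quotient joing1G.
Qed.

Lemma frattini_gen_subgroup N P :
  P \subset 'Phi(P) <*> N -> N \subset P -> N :=: P.
Proof.
move=> sP sN; rewrite -[LHS]genGid; apply: Phi_nongen; apply/eqP.
by rewrite eqEsubset sP join_subG Phi_sub sN.
Qed.

Lemma card_cons_tuple (T : finType) n (Q : pred (n.+1.-tuple T)) :
  #|Q| = (\sum_(t : n.-tuple T) #|[pred x | Q (cons_tuple x t)]|)%N.
Proof.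
rewrite -sum1_card.
rewrite (reindex (fun xt : T * n.-tuple T => cons_tuple xt.1 xt.2)) /=; last first.
  exists (fun t : n.+1.-tuple T => (thead t, [tuple of behead t])).
    by move=> [x t] _ /=; congr pair; apply: val_inj.
  by move=> t _; rewrite [RHS]tuple_eta; apply: val_inj.
rewrite (eq_bigl (fun i : T * n.-tuple T => xpredT i.1 && (Q (cons_tuple i.1 i.2)))) //.
rewrite -(pair_big_dep xpredT (fun x t => Q (cons_tuple x t)) (fun _ _ => 1%N)) /=.
rewrite (exchange_big_dep xpredT) //=; apply: eq_bigr => t _.
by rewrite sum1_card.
Qed.

Section ElementaryAbelian.
Variables (p : nat) (V : {group gT}).
Hypotheses (p_pr : prime p) (abV : p.-abelem V).

Lemma gen_seq_sub (t : seq gT) : all (mem V) t -> <<[set x in t]>> \subset V.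
Proof.
by move=> Vt; rewrite gen_subG; apply/subsetP => x; rewrite inE => /(allP Vt).
Qed.

(** Dimension over F_p is measured by the order of a span: adjoining x changes nothing or multiplies
    the order by p, because outside the span [<[x]>] has prime order and meets the span
    trivially. *)
Lemma card_gen_cons x (t : seq gT) : x \in V -> all (mem V) t ->
  #|<<[set y in x :: t]>>| =
    (if x \in <<[set y in t]>> then #|<<[set y in t]>>|
     else p * #|<<[set y in t]>>|)%N.
Proof.
move=> Vx Vt; set H := <<[set y in t]>>.
have sHV : H \subset V := gen_seq_sub Vt.
have -> : <<[set y in x :: t]>> = <[x]> <*> H.
  rewrite /cycle joing_idl joing_idr; congr << _ >>.
  by apply/setP => y; rewrite !inE.
case: ifP => Hx.
  by congr #|pred_of_set _|; apply/joing_idPr; rewrite cycle_subG.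
have x1 : x != 1 by apply: contraFneq Hx => ->; exact: group1.
have ox : #[x] = p := abelem_order_p abV Vx x1.
rewrite cent_joinEr ?(sub_abelian_cent2 (abelem_abelian abV)) ?cycle_subG //.
rewrite TI_cardMg -/(#[x]) ?ox //.
by rewrite prime_TIg -/(#[x]) ?ox ?cycle_subG ?Hx.
Qed.

Lemma card_gen_seq (t : seq gT) : all (mem V) t ->
  (#|<<[set x in t]>>| <= p ^ size t)%N.
Proof.
elim: t => [_|x t IH /andP[Vx Vt]].
  have -> : [set x in [::]] = set0 :> {set gT} by apply/setP => x; rewrite !inE.
  by rewrite gen0 cards1.
rewrite card_gen_cons //= expnS; case: ifP => _; last by rewrite leq_mul2l IH ?orbT.
by apply: leq_trans (IH Vt) _; rewrite leq_pmull ?prime_gt0.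
Qed.

(* Ordered tuples in [V] that are linearly independent over [F_p]. *)
Lemma card_free_tuples (k n : nat) : #|V| = (p ^ k)%N ->
  #|[pred t : n.-tuple gT | all (mem V) t && (#|<<[set x in t]>>| == p ^ n)%N]|
    = (\prod_(i < n) (p ^ k - p ^ i))%N.
Proof.
move=> cV; elim: n => [|n IH].
  rewrite big_ord0 -[RHS](card_tuple 0 gT); apply: eq_card => t.
  rewrite !inE tuple0 /=; apply/eqP.
  have -> : [set x in [::]] = set0 :> {set gT} by apply/setP => x; rewrite !inE.
  by rewrite gen0 cards1.
rewrite big_ord_recr /= -IH card_cons_tuple.
rewrite -[X in (X * _)%N]sum1_card big_distrl /= big_mkcond [RHS]big_mkcond /=.
apply: eq_bigr => t _; rewrite !inE mul1n.
have [Vt|Vt] /= := boolP (all (mem V) t); last first.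
  by apply: eq_card0 => x; apply/negP => /andP[/= /andP[_ Vt1] _]; case/negP: Vt.
have sHV := gen_seq_sub Vt.
have := card_gen_seq Vt; rewrite size_tuple.
set H := <<[set x in t]>> => leH.
have p_gt0 := prime_gt0 p_pr; have p_gt1 := prime_gt1 p_pr.
(* By [leH] the tail spans at most p^n elements, so order p^(n+1) is reached only with x outside
   that span and the tail itself independent. *)
have e (x : gT) : (all (mem V) (x :: t)) && (#|<<[set y in x :: t]>>| == p ^ n.+1)%N
    = (x \in V) && ((x \notin H) && (#|H| == p ^ n)%N).
  rewrite /= Vt andbT; case Vx: (x \in V) => //=.
  rewrite card_gen_cons // -/H; case: ifP => Hx /=; last by rewrite expnS eqn_pmul2l.
  by apply: ltn_eqF; apply: leq_ltn_trans leH _; rewrite ltn_exp2l.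
rewrite (eq_card (B := [pred x | (x \in V) && ((x \notin H) && (#|H| == p ^ n)%N)])); last first.
  by move=> x; rewrite [RHS]inE -e [LHS]inE /= Vt.
have [cH|cH] := eqVneq #|H| (p ^ n)%N; last first.
  by apply: eq_card0 => x; rewrite !inE !andbF.
rewrite -cV -cH -(cardsDS sHV); apply: eq_card => x; rewrite !inE ?andbT.
by rewrite andbC.
Qed.

Lemma exists_free_generators k : #|V| = (p ^ k)%N ->
  exists t : k.-tuple gT, all (mem V) t /\ <<[set x in t]>> = V.
Proof.
move=> cV.
have : (0 < #|[pred t : k.-tuple gT | all (mem V) t && (#|<<[set x in t]>>| == p ^ k)]|)%N.
  rewrite (card_free_tuples _ cV) prodn_gt0 // => i.
  by rewrite subn_gt0 ltn_exp2l ?prime_gt1.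
case/card_gt0P => t; rewrite inE => /andP[Vt /eqP ct]; exists t; split=> //.
by apply/eqP; rewrite eqEcard gen_seq_sub // ct cV leqnn.
Qed.

End ElementaryAbelian.
End FiniteGroups.

From mathcomp Require Import zify finmap.
From mathcomp Require Import all_classical all_reals all_analysis.
From mathcomp Require Import measurable_realfun.
Import generic_quotient Defs.

(** * Finite quotients of pro-p groups *)

Section FiniteCopy.
Local Open Scope classical_set_scope.
Local Open Scope group_scope.

(** The finiteness proof sits in the type as a phantom argument, so that a group whose carrier is
    only known to be finite as a set can receive the instances of a finite group. *)
Definition fin_copy (G : groupType) (_ : finite_set [set: G]) : Type := G.

Variables (G : groupType) (Gfin : finite_set [set: G]).
Local Notation T := (fin_copy Gfin).
Let e : seq G := fset_set [set: G].

Lemma mem_fin_copy_enum (x : G) : x \in e.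
Proof. by rewrite in_fset_set // in_setT. Qed.

HB.instance Definition _ := Group.on T.

Lemma fin_copy_pickleK :
  pcancel ((index^~ e) : T -> nat) ((fun n => Some (nth 1 e n)) : nat -> option T).
Proof. by move=> x; rewrite /= nth_index ?mem_fin_copy_enum. Qed.

HB.instance Definition _ := isCountable.Build T fin_copy_pickleK.

Lemma fin_copy_enumP : Finite.axiom (e : seq T).
Proof.
move=> x; rewrite count_uniq_mem; last exact: fset_uniq.
by have -> : x \in (e : seq T) by exact: mem_fin_copy_enum.
Qed.

HB.instance Definition _ := fintype.isFinite.Build T fin_copy_enumP.

Lemma card_fin_copy (A : set G) : card_set A = #|[pred x : T | `[< A x >]]|.
Proof.
rewrite /card_set cardE; apply/perm_size/uniq_perm.
- exact: fset_uniq.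
- exact: enum_uniq.
move=> x; rewrite in_fset_set; last exact: sub_finite_set Gfin.
apply/esym; rewrite -[RHS]/([pred x : T | `[< A x >]] x).
exact: (mem_enum [pred x : T | `[< A x >]] (x : T)).
Qed.

End FiniteCopy.

Section SubgroupSets.
Local Open Scope classical_set_scope.
Local Open Scope group_scope.

Lemma morph1_of (G H : groupType) (f : G -> H) : {morph f : x y / x * y} -> f 1 = 1.
Proof. by move=> fM; apply: (mulgI (f 1)); rewrite -fM !mulg1. Qed.

Lemma morphV_of (G H : groupType) (f : G -> H) : {morph f : x y / x * y} ->
  {morph f : x / x^-1}.
Proof. by move=> fM x; apply: (mulgI (f x)); rewrite -fM !mulgV morph1_of. Qed.

Lemma morphX_of (G H : groupType) (f : G -> H) : {morph f : x y / x * y} ->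
  forall n, {morph f : x / x ^+ n}.
Proof.
move=> fM; elim=> [|n IH] x; first by rewrite !expg0 morph1_of.
by rewrite !expgS fM IH.
Qed.

Lemma morphJ_of (G H : groupType) (f : G -> H) : {morph f : x y / x * y} ->
  {morph f : x y / x ^ y}.
Proof. by move=> fM x y; rewrite /conjg !fM morphV_of. Qed.

Lemma morphR_of (G H : groupType) (f : G -> H) : {morph f : x y / x * y} ->
  {morph f : x y / [~ x, y]}.
Proof. by move=> fM x y; rewrite /commg fM morphV_of // morphJ_of. Qed.

Lemma morph_comp (G H K : groupType) (f : G -> H) (g : H -> K) :
  {morph f : x y / x * y} -> {morph g : x y / x * y} ->
  {morph g \o f : x y / x * y}.
Proof. by move=> fM gM x y /=; rewrite fM gM. Qed.

Variable G : topGroupType.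
Implicit Types (A B H K N U : set G).

Lemma subgroup_setX H x n : subgroup_set H -> H x -> H (x ^+ n).
Proof.
by move=> [H1 HM _] Hx; elim: n => [|n IH]; rewrite ?expg0 // expgS; exact: HM.
Qed.

Lemma closed_gen_sub A K : closed K -> subgroup_set K -> A `<=` K -> closed_gen A `<=` K.
Proof. by move=> Kc Kg AK; exact: smallest_sub. Qed.

Lemma closed_genS A B : A `<=` B -> closed_gen A `<=` closed_gen B.
Proof.
move=> AB; apply: closed_gen_sub; [exact: closed_gen_closed|exact: closed_gen_subgroup|].
by apply: subset_trans (@sub_closed_gen _ B).
Qed.

Lemma subgroup_set1 : subgroup_set [set (1 : G)].
Proof.
by split=> [//|x y -> ->|x ->]; rewrite /= ?mulg1 ?invg1.
Qed.

Lemma subgroup_setI H K : subgroup_set H -> subgroup_set K -> subgroup_set (H `&` K).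
Proof.
move=> [H1 HM HV] [K1 KM KV]; split; first by split.
- by move=> x y [Hx Kx] [Hy Ky]; split; [exact: HM|exact: KM].
- by move=> x [Hx Kx]; split; [exact: HV|exact: KV].
Qed.

Lemma normal_setI H K : normal_set H -> normal_set K -> normal_set (H `&` K).
Proof.
move=> [Hg HJ] [Kg KJ]; split; first exact: subgroup_setI.
by move=> x g [Hx Kx]; split; [exact: HJ|exact: KJ].
Qed.

Lemma subgroup_preim (L : groupType) (f : G -> L) (P : L -> Prop) :
  {morph f : x y / x * y} -> P 1 -> (forall x y, P x -> P y -> P (x * y)) ->
  (forall x, P x -> P x^-1) -> subgroup_set [set x | P (f x)].
Proof.
move=> fM P1 PM PV; split=> /=.
- by rewrite morph1_of.
- by move=> x y Px Py; rewrite fM; exact: PM.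
- by move=> x Px; rewrite morphV_of //; exact: PV.
Qed.

Lemma mull_continuous (g : G) : continuous (fun x => g * x).
Proof.
move=> x; apply: (@continuous_comp _ _ _ (fun x => (g, x)) (fun xy => xy.1 * xy.2)).
  by apply: cvg_pair; [exact: cvg_cst|exact: cvg_id].
exact: mulg_continuous.
Qed.

Lemma open_translates U B : open U -> U 1 ->
  (forall x y, U (x^-1 * y) -> B x -> B y) -> open B.
Proof.
move=> oU U1 UB; rewrite openE => x Bx.
rewrite /interior; apply: (@filterS _ _ _ ((fun y => x^-1 * y) @^-1` U)).
  by move=> y Uy; exact: UB Bx.
apply: open_nbhs_nbhs; split; last by rewrite /= mulVg.
by apply: open_comp oU => y _; exact: mull_continuous.
Qed.

(** B and its complement are both unions of left cosets of the open subgroup U. *)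
Lemma clopen_translates U B : open U -> subgroup_set U ->
  (forall x y, U (x^-1 * y) -> B x -> B y) -> open B /\ closed B.
Proof.
move=> oU [U1 UM UV] UB; split; first exact: open_translates UB.
rewrite -openC; apply: (open_translates oU) => // x y Uxy nBx By; apply: nBx.
by apply: UB By; have := UV _ Uxy; rewrite invgM invgK.
Qed.

Lemma open_subgroup_closed U : open U -> subgroup_set U -> closed U.
Proof.
move=> oU Ug; have [] // := @clopen_translates U U oU Ug.
case: Ug => _ UM _ x y Uxy Ux.
by rewrite -[y](mul1g y) -(mulgV x) -mulgA; exact: UM.
Qed.

End SubgroupSets.

Section ProPQuotients.
Local Open Scope classical_set_scope.
Local Open Scope group_scope.
Variables (p : nat) (G : sigmaGroupType).
Hypothesis GP : pro_p p G.

(** The open normal N supplied by [pro_p] may fail to be sigma-stable; its intersection with its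
    preimage under the involution is stable, as [quot] requires. *)
Lemma pro_p_separate (A : set G) z : closed A -> ~ A z ->
  exists U : sigmaNormal G, open (normal_carrier U) /\ forall u, normal_carrier U u -> ~ A (z * u).
Proof.
move=> Ac nAz; case: GP => _ _ Gb _.
have /Gb [N [No Nn NA]] : nbhs (1 : G) ((fun u => z * u) @^-1` (~` A)).
  apply: open_nbhs_nbhs; split; last by rewrite /= mulg1.
  by apply: open_comp => [x _|]; [exact: mull_continuous|exact: closed_openC].
have sn : normal_set (sigma @^-1` N).
  case: Nn => -[N1 NM NV] NJ; split; first split=> /=.
  - by rewrite sigma1.
  - by move=> x y Nx Ny; rewrite sigmaM; exact: NM.
  - by move=> x Nx; rewrite sigmaV; exact: NV.
  - by move=> x g Nx; rewrite /= /conjg !sigmaM sigmaV; exact: NJ.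
have so : open (sigma @^-1` N).
  by apply: open_comp => // x _; exact: sigma_continuous.
have ss x : (N `&` sigma @^-1` N) x -> (N `&` sigma @^-1` N) (sigma x).
  by case=> Nx Nsx; split=> //=; rewrite sigmaK.
exists (SigmaNormal (normal_setI Nn sn) ss); split; first exact: openI.
by move=> u [/NA].
Qed.

Lemma card_lcosets_quot (U : sigmaNormal G) : ([set: quot U] #= Defs.lcosets (normal_carrier U))%card.
Proof.
have [[U1 UM UV] _] := normal_carrierP U.
pose f (a : quot U) := [set repr a * y | y in normal_carrier U].
have -> : Defs.lcosets (normal_carrier U) = f @` setT.
  apply/seteqP; split=> [_ [x _ <-]|_ [a _ <-]]; last by exists (repr a).
  exists (\pi_(quot U)%qT x) => //; have Ux := @repr_pi _ U x.
  apply/seteqP; split=> _ [y Uy <-] /=.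
    exists (x^-1 * repr (\pi_(quot U)%qT x) * y); first exact: UM.
    by rewrite !mulgA mulgV mul1g.
  exists ((x^-1 * repr (\pi_(quot U)%qT x))^-1 * y); first by apply: UM => //; exact: UV.
  by rewrite invgM invgK !mulgA mulgV mul1g.
rewrite card_eq_sym; apply: inj_card_eq => a b _ _ e.
rewrite -[a](@reprK _ (quot U)) -[b](@reprK _ (quot U)); apply/pi_eq.
have : f b (repr a * 1) by rewrite -e; exists 1.
move=> [y Uy]; rewrite mulg1 => <-.
by rewrite invgM -mulgA mulVg mulg1; exact: UV.
Qed.

Lemma card_pro_p_quot (U : sigmaNormal G) : open (normal_carrier U) ->
  exists k, ([set: quot U] #= `I_(p ^ k))%card.
Proof.
case: GP => _ _ _ Gi oU; have [k Uk] := Gi _ oU (normal_carrierP U).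
by exists k; exact: card_eq_trans (card_lcosets_quot U) Uk.
Qed.

Lemma finite_quot (U : sigmaNormal G) : open (normal_carrier U) ->
  finite_set [set: quot U].
Proof. by move=> /card_pro_p_quot [k]; exists (p ^ k)%N. Qed.

Lemma pgroup_quot (p_pr : prime p) (U : sigmaNormal G) (oU : open (normal_carrier U)) :
  p.-group [set: fin_copy (finite_quot oU)]%SET.
Proof.
have [k /card_fset_set] := card_pro_p_quot oU.
rewrite -/(card_set _) (card_fin_copy (finite_quot oU)) => e.
rewrite /pgroup cardsT (eq_card (B :=
  [pred x : fin_copy (finite_quot oU) | `[< [set: quot U] x >]])).
  by rewrite e pnatX pnat_id ?orbT.
by move=> x; rewrite !inE; apply/esym/asboolP.
Qed.

End ProPQuotients.

(** * Frattini arguments in pro-p groups *)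

Section Frattini.
Local Open Scope classical_set_scope.
Local Open Scope group_scope.

Lemma image_group (G : topGroupType) (Q : finGroupType) (f : G -> Q) (A : set G) :
  {morph f : x y / x * y} -> subgroup_set A ->
  exists H : {group Q}, forall q, q \in H <-> exists2 a, A a & f a = q.
Proof.
move=> fM [A1 AM AV].
pose B : {set Q} := [set q : Q | `[< exists2 a, A a & f a = q >]]%SET.
have BP q : q \in B <-> exists2 a, A a & f a = q.
  by rewrite inE; split=> /asboolP.
have gB : group_set B.
  apply/group_setP; split; first by apply/BP; exists 1 => //; exact: morph1_of.
  move=> _ _ /BP[a Aa <-] /BP[b Ab <-]; apply/BP; exists (a * b) => //.
  exact: AM.
by exists (Group gB).
Qed.

(** Commutators are taken with all of G, not only with N. For N = G in a pro-p group these elements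
    generate the Frattini subgroup. *)
Definition frattini_gens (p : nat) (G : topGroupType) (N : set G) : set G :=
  [set x ^+ p | x in N] `|` [set z | exists x g, N x /\ z = [~ x, g]].

Variables (p : nat) (G : sigmaGroupType).
Hypotheses (p_pr : prime p) (GP : pro_p p G).

(* A closed set is the intersection of its saturations by open normal subgroups. *)
Lemma sub_by_finite_quotients (A N : set G) : closed A ->
  (forall (Q : finGroupType) (f : G -> Q), {morph f : x y / x * y} ->
     (forall q, exists x, f x = q) -> p.-group [set: Q]%SET ->
     (forall B : Q -> Prop, closed [set x | B (f x)]) ->
     forall x, N x -> exists2 a, A a & f a = f x) ->
  N `<=` A.
Proof.
move=> Ac h z Nz; apply: contrapT => nAz.
have [U [oU zU]] := pro_p_separate GP Ac nAz.
have [Ug _] := normal_carrierP U.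
pose f (x : G) : fin_copy (finite_quot GP oU) := quot_pi U x.
have fM : {morph f : x y / x * y} by move=> x y; rewrite [RHS]quot_piM.
have [|||a Aa] := h _ f fM _ _ _ z Nz.
- by move=> q; have [x ->] := pi_surj (q : quot U); exists x.
- exact: pgroup_quot.
- move=> B; apply: (proj2 (clopen_translates oU Ug _)) => x y /pi_eq xy /=.
  by rewrite /f /quot_pi xy.
by move=> /esym/pi_eq /zU; rewrite mulgA mulgV mul1g.
Qed.

(** A is closed, so the claim is tested in finite p-quotients Q. There p-th powers of N land in
    ['Phi(N')], by the description of the Frattini subgroup of a p-group, and commutators with G
    land in [[~: N', Q]]; the finite lemma applies. *)
Lemma frattini_normal (A N : set G) : closed A -> normal_set A -> normal_set N ->
  A `<=` N -> N `<=` closed_gen (A `|` frattini_gens p N) -> N `<=` A.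
Proof.
move=> Ac [Ag AJ] [Ng NJ] AN sN; apply: sub_by_finite_quotients => // Q f fM fs Qp fB.
have [A' A'P] := image_group fM Ag; have [N' N'P] := image_group fM Ng.
have nrm (H : set G) (H' : {group Q}) : (forall x g, H x -> H (x ^ g)) ->
    (forall q, q \in H' <-> exists2 a, H a & f a = q) -> normal H' [set: Q]%SET.
  move=> HJ H'P; apply/andP; split; first exact: finset.subsetT.
  apply/normsP => y _.
  apply/eqP; rewrite finset.eqEcard cardJg leqnn andbT;
    apply/fintype.subsetP => _ /imsetP[_ /H'P[a Ha <-] ->].
  have [g <-] := fs y; rewrite -morphJ_of //; apply/H'P; exists (a ^ g) => //; exact: HJ.
have sub : N' \subset 'Phi(N') <*> (A' <*> [~: N', [set: Q]%SET]).
  apply/fintype.subsetP => _ /N'P[x /sN Nx <-]; move: x Nx.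
  apply: closed_gen_sub; first exact: (fB (fun q => q \in _)).
    by apply: (@subgroup_preim _ _ f (fun q => q \in _)) => // *; [exact: groupM|rewrite groupV].
  move=> z [Az|[[x Nx <-]|[x [g [Nx ->]]]]] /=.
  - rewrite mem_gen // inE mem_gen ?orbT // inE; apply/orP; left.
    by apply/A'P; exists z.
  - rewrite mem_gen // inE; apply/orP; left.
    rewrite (Phi_joing (pgroupS (finset.subsetT _) Qp)) mem_gen // inE; apply/orP; right.
    rewrite (MhoE 1 (pgroupS (finset.subsetT _) Qp)) mem_gen //; apply/imsetP; exists (f x).
      by apply/N'P; exists x.
    by rewrite expn1 morphX_of.
  - rewrite mem_gen // inE mem_gen ?orbT // inE; apply/orP; right.
    by rewrite morphR_of // mem_commg ?inE //; apply/N'P; exists x.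
have sAN' : A' \subset N'.
  by apply/fintype.subsetP => _ /A'P[a Aa <-]; apply/N'P; exists a => //; exact: AN.
have /fintype.subsetP NA := pgroup_normal_frattini Qp (nrm _ _ AJ A'P) (nrm _ _ NJ N'P) sAN' sub.
by move=> x Nx; apply/A'P/NA/N'P; exists x.
Qed.

(** K need not be normal, so the finite step is the non-generator property of the Frattini subgroup
    of the whole quotient. *)
Lemma frattini_gen (K : set G) : closed K -> subgroup_set K ->
  closed_gen (K `|` frattini_gens p setT) = setT -> K = setT.
Proof.
move=> Kc Kg e; apply/seteqP; split=> //.
apply: sub_by_finite_quotients => // Q f fM fs Qp fB x _.
have [K' K'P] := image_group fM Kg.
have sub : [set: Q]%SET \subset 'Phi([set: Q]%SET) <*> K'.
  apply/fintype.subsetP => q _; have [y <-] := fs q.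
  have : closed_gen (K `|` frattini_gens p setT) y by rewrite e.
  move: y; apply: closed_gen_sub; first exact: (fB (fun q => q \in _)).
    by apply: (@subgroup_preim _ _ f (fun q => q \in _)) => // *; [exact: groupM|rewrite groupV].
  move=> z [Kz|[[y _ <-]|[y [g [_ ->]]]]] /=.
  - by rewrite mem_gen // inE; apply/orP; right; apply/K'P; exists z.
  - rewrite mem_gen // inE; apply/orP; left.
    rewrite (Phi_joing Qp) mem_gen // inE; apply/orP; right.
    rewrite (MhoE 1 Qp) mem_gen //; apply/imsetP; exists (f y) => //.
    by rewrite expn1 morphX_of.
  - rewrite mem_gen // inE; apply/orP; left.
    rewrite (Phi_joing Qp) mem_gen // inE; apply/orP; left.
    by rewrite morphR_of // mem_commg ?inE.
have e' := frattini_gen_subgroup sub (finset.subsetT _).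
by apply/K'P; rewrite e' inE.
Qed.

End Frattini.

(** * The quotient N / N^p [N, G] *)

Section FrattiniQuotient.
Local Open Scope classical_set_scope.
Local Open Scope group_scope.

Lemma finite_hausdorff_open (T : topologicalType) (A : set T) :
  finite_set [set: T] -> hausdorff_space T -> open A.
Proof.
move=> Tfin /hausdorff_accessible/accessible_finite_set_closed Tc.
by rewrite -[A]setCK openC; apply: Tc; exact: sub_finite_set Tfin.
Qed.

(** E is not yet known to be finite. Since the members of l are central of exponent p, adjoining one
    more of them gives elements with the normal form s^a t, a < p. *)
Lemma finite_central_subgroup (p : nat) (E : groupType) (l : seq E) : (0 < p)%N ->
  (forall x, x \in l -> x ^+ p = 1 /\ forall y, commute x y) ->
  exists T : set E, [/\ finite_set T, T 1, forall x y, T x -> T y -> T (x * y),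
    forall x, T x -> T x^-1 & forall x, x \in l -> T x].
Proof.
move=> p_gt0; elim: l => [_|s l IH lP].
  exists [set 1]; split=> //.
    by move=> x y -> ->; rewrite /= mulg1.
  by move=> x ->; rewrite /= invg1.
have [x xl|T [Tf T1 TM TV Tl]] := IH; first by apply: lP; rewrite inE xl orbT.
have [sp sc] := lP s (mem_head _ _).
have sX x a : commute (s ^+ a) x by apply/commute_sym/commuteX/commute_sym.
have modX a : s ^+ a = s ^+ (a %% p).
  by rewrite {1}(divn_eq a p) expgD mulnC expgM sp expg1n mul1g.
exists [set x | exists a t, T t /\ x = s ^+ a * t]; split.
- apply: (@sub_finite_set _ _ ((fun at_ : nat * E => s ^+ at_.1 * at_.2) @` (`I_p `*` T))).
    move=> _ [a [t [Tt ->]]]; exists (a %% p, t)%N; last by rewrite /= -modX.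
    by split=> //=; rewrite ltn_pmod.
  by apply: finite_image; apply: finite_setX => //; exact: finite_II.
- by exists 0%N, 1; rewrite expg0 mulg1.
- move=> _ _ [a [t [Tt ->]]] [b [u [Tu ->]]]; exists (a + b)%N, (t * u); split; first exact: TM.
  by rewrite expgD -!mulgA [t * (_ * u)]mulgA -(sX t b) !mulgA.
(* As s^p = 1, the power s^(a(p-1)) is the inverse of s^a. *)
- move=> _ [a [t [Tt ->]]]; exists (a * p.-1)%N, t^-1; split; first exact: TV.
  rewrite invgM (commuteV (commute_sym (sX t^-1 a))); congr (_ * _); apply: (mulgI (s ^+ a));
    rewrite mulgV.
  by rewrite -expgD -mulnS prednK // mulnC expgM sp expg1n.
- move=> x; rewrite inE => /orP[/eqP ->|/Tl Tx]; first by exists 1%N, 1; rewrite expg1 mulg1.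
  by exists 0%N, x; rewrite expg0 mul1g.
Qed.

Section QuotPi.
Variables (G : sigmaGroupType) (N : sigmaNormal G).

Lemma quot_pi_surj (a : quot N) : exists x, quot_pi N x = a.
Proof. by have [x ->] := pi_surj a; exists x. Qed.

Lemma quot_pi_morphM : {morph quot_pi N : x y / x * y}.
Proof. by move=> x y; rewrite [RHS]quot_piM. Qed.

Lemma quot_pi_morph_sigma : {morph quot_pi N : x / sigma x}.
Proof. by move=> x; rewrite [RHS]quot_pi_sigma. Qed.

Lemma quot_pi_eq (x y : G) : quot_pi N x = quot_pi N y <-> normal_carrier N (x^-1 * y).
Proof. exact: pi_eq. Qed.

Lemma quot_pi_eq1 (x : G) : quot_pi N x = 1 <-> normal_carrier N x.
Proof.
rewrite -(morph1_of quot_pi_morphM); split=> [/esym/quot_pi_eq|Nx].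
  by rewrite invg1 mul1g.
by apply/esym/quot_pi_eq; rewrite invg1 mul1g.
Qed.

End QuotPi.

Section FrattiniN.
Variables (p : nat) (G : sigmaGroupType) (N : sigmaNormal G).

Lemma frattini_gens_conj x g :
  frattini_gens p (normal_carrier N) x -> frattini_gens p (normal_carrier N) (x ^ g).
Proof.
have [_ NJ] := normal_carrierP N.
move=> [[y Ny <-]|[y [h [Ny ->]]]].
  by left; exists (y ^ g); [exact: NJ|rewrite conjXg].
by right; exists (y ^ g), (h ^ g); split; [exact: NJ|rewrite conjRg].
Qed.

Lemma frattini_gens_sigma x :
  frattini_gens p (normal_carrier N) x -> frattini_gens p (normal_carrier N) (sigma x).
Proof.
have Ns := @normal_carrier_sigma _ N.
move=> [[y Ny <-]|[y [h [Ny ->]]]].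
  by left; exists (sigma y); [exact: Ns|rewrite (morphX_of (@sigmaM G))].
right; exists (sigma y), (sigma h); split; first exact: Ns.
by rewrite (morphR_of (@sigmaM G)).
Qed.

Lemma frattiniN_sigma x : closed_gen (frattini_gens p (normal_carrier N)) x ->
  closed_gen (frattini_gens p (normal_carrier N)) (sigma x).
Proof.
apply: closed_gen_map; [exact: sigma_continuous|exact: sigmaM|].
by move=> {}x /frattini_gens_sigma; exact: sub_closed_gen.
Qed.

(* [N^p [N, G]], so that [N / frattiniN] is the largest quotient of [N] that is
   elementary abelian and central in [G]. *)
Definition frattiniN : sigmaNormal G :=
  SigmaNormal (closed_gen_normal frattini_gens_conj) frattiniN_sigma.

Lemma frattiniN_closed : closed (normal_carrier frattiniN).
Proof. exact: closed_gen_closed. Qed.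

Lemma frattiniN_sub : closed (normal_carrier N) -> normal_carrier frattiniN `<=` normal_carrier N.
Proof.
have [Ng NJ] := normal_carrierP N; have [_ NM NV] := Ng.
move=> Nc; apply: closed_gen_sub => // _ [[x Nx <-]|[x [g [Nx ->]]]].
  exact: subgroup_setX.
by apply: NM; [exact: NV|exact: NJ].
Qed.

Lemma quot_frattiniX x : normal_carrier N x -> (quot_pi frattiniN x) ^+ p = 1.
Proof.
move=> Nx; rewrite -(morphX_of (@quot_pi_morphM _ _)); apply/quot_pi_eq1.
by apply: sub_closed_gen; left; exists x.
Qed.

Lemma quot_frattini_central x (a : quot frattiniN) : normal_carrier N x ->
  commute (quot_pi frattiniN x) a.
Proof.
move=> Nx; have [y <-] := quot_pi_surj a.
rewrite /commute -!quot_pi_morphM; apply/esym/quot_pi_eq.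
apply: sub_closed_gen; right; exists x, y; split=> //.
by rewrite commgEl /conjg invgM !mulgA.
Qed.

Hypothesis (p_gt0 : (0 < p)%N).

Section Relators.
Variables (k : nat) (s : k.-tuple (minus_borel G)).
Hypothesis Ns : normal_carrier N = closed_gen (relators s).

(** The image of N is central, so a relator and its conjugates have the same image. The k images lie
    in a finite subgroup, which is closed in a Hausdorff group and hence contains the image of the
    whole closure N. *)
Lemma frattini_image_finite : hausdorff_space (quot frattiniN) ->
  finite_set (quot_pi frattiniN @` normal_carrier N).
Proof.
move=> Eh; pose l := [seq quot_pi frattiniN (minus_val a) | a <- s].
have [|T [Tf T1 TM TV Tl]] := @finite_central_subgroup p _ l p_gt0.
  move=> ? /mapP[a /tnthP[i ->] ->].
  have Na : normal_carrier N (minus_val (tnth s i)).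
    by rewrite Ns; apply: sub_closed_gen; exists i, 1; rewrite conjg1.
  by split=> [|y]; [exact: quot_frattiniX|exact: quot_frattini_central].
apply: (sub_finite_set _ (Tf)) => _ [x Nx <-]; move: Nx; rewrite {1}Ns.
apply: (@closed_gen_sub _ _ (quot_pi frattiniN @^-1` T)).
- apply: (@preimage_closed _ _ (quot_pi frattiniN) T) => [? _|]; first exact: quot_pi_continuous.
  have /accessible_finite_set_closed h := hausdorff_accessible Eh.
  exact: h Tf.
- exact: subgroup_preim (@quot_pi_morphM _ _) T1 TM TV.
move=> _ [i [g ->]] /=.
have Na : normal_carrier N (minus_val (tnth s i)).
  by rewrite Ns; apply: sub_closed_gen; exists i, 1; rewrite conjg1.
rewrite (morphJ_of (@quot_pi_morphM _ _)) /conjg (quot_frattini_central _ Na).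
by rewrite mulgA mulVg mul1g; apply/Tl/map_f/mem_tnth.
Qed.

(** Representatives modulo N times the finite image of N exhaust the quotient; a finite Hausdorff
    quotient is discrete. *)
Lemma frattiniN_open : pro_p p G -> open (normal_carrier N) ->
  open (normal_carrier frattiniN).
Proof.
move=> GP No; have [_ Eh _ _] := pro_p_quot frattiniN_closed GP.
have Efin : finite_set [set: quot frattiniN].
  have Qfin := finite_quot GP No.
  have Vfin := frattini_image_finite Eh.
  apply: (@sub_finite_set _ _ ((fun ab : quot N * quot frattiniN =>
      quot_pi frattiniN (repr ab.1) * ab.2) @` ([set: quot N] `*` (quot_pi frattiniN @` normal_carrier N)))).
    move=> a _; have [x <-] := quot_pi_surj a.
    exists (quot_pi N x, quot_pi frattiniN ((repr (quot_pi N x))^-1 * x)).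
      split=> //=; exists ((repr (quot_pi N x))^-1 * x) => //.
      by apply/quot_pi_eq; rewrite /quot_pi reprK.
    by rewrite /= -quot_pi_morphM mulgA mulgV mul1g.
  by apply: finite_image; exact: finite_setX.
have -> : normal_carrier frattiniN = quot_pi frattiniN @^-1` [set 1].
  by apply/seteqP; split=> x /quot_pi_eq1.
apply: open_comp => [x _|]; first exact: quot_pi_continuous.
exact: finite_hausdorff_open.
Qed.

End Relators.
End FrattiniN.
End FrattiniQuotient.

Section FrattiniFinite.
Local Open Scope classical_set_scope.
Local Open Scope group_scope.
Variables (p : nat) (G : sigmaGroupType) (N : sigmaNormal G).
Hypotheses (p_pr : prime p) (GP : pro_p p G).
Hypotheses (No : open (normal_carrier N)) (Mo : open (normal_carrier (frattiniN p N))).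

Local Notation M := (frattiniN p N).
Local Notation E := (fin_copy (finite_quot GP Mo)).

Definition frattini_proj (x : G) : E := quot_pi M x.
Local Notation f := frattini_proj.

Lemma frattini_projM : {morph f : x y / x * y}.
Proof. exact: quot_pi_morphM. Qed.

Definition frattini_image_set : {set E} :=
  [set q : E | `[< exists2 x, normal_carrier N x & f x = q >]]%SET.

Lemma frattini_image_setP q :
  q \in frattini_image_set <-> exists2 x, normal_carrier N x & f x = q.
Proof. by rewrite inE; split=> /asboolP. Qed.

Lemma frattini_image_group_set : group_set frattini_image_set.
Proof.
have [[N1 NM _] _] := normal_carrierP N.
apply/group_setP; split.
  by apply/frattini_image_setP; exists 1 => //; exact: morph1_of frattini_projM.
move=> _ _ /frattini_image_setP[x Nx <-] /frattini_image_setP[y Ny <-].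
by apply/frattini_image_setP; exists (x * y); [exact: NM|exact: frattini_projM].
Qed.

Canonical frattini_image := Group frattini_image_group_set.
Local Notation V := frattini_image.

Lemma normal_open_closed : closed (normal_carrier N).
Proof. by apply: open_subgroup_closed => //; case: (normal_carrierP N). Qed.

Lemma mem_frattini_image x : f x \in V <-> normal_carrier N x.
Proof.
split=> [/frattini_image_setP[y Ny]|Nx]; last by apply/frattini_image_setP; exists x.
move=> /quot_pi_eq /(frattiniN_sub normal_open_closed) Nyx.
have [[_ NM _] _] := normal_carrierP N.
by rewrite -[x](mul1g x) -(mulgV y) -mulgA; exact: NM.
Qed.

Lemma frattini_image_central v q : v \in V -> commute v q.
Proof. by move=> /frattini_image_setP[x Nx <-]; exact: quot_frattini_central. Qed.

Lemma frattini_image_abelem : p.-abelem V.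
Proof.
apply/(abelemP p_pr); split.
  apply/centsP => v Vv w _; exact: frattini_image_central.
by move=> _ /frattini_image_setP[x Nx <-]; exact: quot_frattiniX.
Qed.

(** From left to right, centrality of V makes conjugates of a relator add nothing to the span. From
    right to left, every x in N agrees modulo N^p [N, G] with an element of the normal closure,
    which is the hypothesis of [frattini_normal]. *)
Lemma closed_gen_relators_eq k (r : k.-tuple (minus_borel G)) :
  closed_gen (relators r) = normal_carrier N <->
  all (mem V) [seq f (minus_val a) | a <- r] /\
  <<[set q in [seq f (minus_val a) | a <- r]]>> = V.
Proof.
have [Ng NJ] := normal_carrierP N; have [_ NM NV] := Ng.
set l := map _ _; split=> [rN|[Vl lV]].
  have Nr i : normal_carrier N (minus_val (tnth r i)).
    by rewrite -rN; apply: sub_closed_gen; exists i, 1; rewrite conjg1.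
  have Vl : all (mem V) l.
    by apply/allP => _ /mapP[a /tnthP[i ->] ->]; apply/mem_frattini_image.
  split=> //; apply/eqP; rewrite finset.eqEsubset gen_seq_sub //=.
  apply/fintype.subsetP => _ /frattini_image_setP[x Nx <-]; move: Nx; rewrite -rN.
  apply: (@closed_gen_sub _ _ [set x | f x \in <<[set q in l]%SET>>]).
  - have [||_ //] := @clopen_translates _ _ [set x | f x \in <<[set q in l]%SET>>] Mo.
      by case: (normal_carrierP M).
    by move=> y z /quot_pi_eq yz /=; rewrite /f /frattini_proj yz.
  - apply: (@subgroup_preim _ _ f (fun q => q \in _) frattini_projM) => //.
      by move=> *; exact: groupM.
    by move=> *; rewrite groupV.
  move=> _ [i [g ->]] /=; rewrite (morphJ_of frattini_projM) /conjg.
  have Vr : f (minus_val (tnth r i)) \in V by apply/mem_frattini_image.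
  rewrite (frattini_image_central (f g) Vr) mulgA mulVg mul1g; apply: mem_gen.
  by rewrite inE; apply/map_f/mem_tnth.
have rN : closed_gen (relators r) `<=` normal_carrier N.
  apply: closed_gen_sub => //; first exact: normal_open_closed.
  move=> _ [i [g ->]]; apply: NJ; apply/mem_frattini_image.
  by apply: (allP Vl); apply/map_f/mem_tnth.
apply/seteqP; split=> //.
apply: (frattini_normal p_pr GP) => //; [exact: closed_gen_closed|exact: relators_normal|].
have [A' A'P] := image_group frattini_projM (closed_gen_subgroup (relators r)).
move=> x Nx.
have : f x \in A'.
  have : f x \in <<[set q in l]%SET>> by rewrite lV; apply/mem_frattini_image.
  apply/fintype.subsetP; rewrite gen_subG; apply/fintype.subsetP => q.
  rewrite inE => /mapP[_ /tnthP[i ->] ->]; apply/A'P; exists (minus_val (tnth r i)) => //.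
  by apply: sub_closed_gen; exists i, 1; rewrite conjg1.
case/A'P => a Aa /quot_pi_eq Max.
have [_ CM _] := closed_gen_subgroup (closed_gen (relators r) `|` frattini_gens p (normal_carrier N)).
rewrite -[x](mul1g x) -(mulgV a) -mulgA; apply: CM.
  by apply: sub_closed_gen; left.
by apply: closed_genS Max => y; right.
Qed.

End FrattiniFinite.

(** * Free pro-p groups *)

Section Discrete.
Local Open Scope classical_set_scope.
Local Open Scope group_scope.

Definition discrete_group (Q : finGroupType) : Type := Q.

Variable Q : finGroupType.
Local Notation T := (discrete_group Q).

HB.instance Definition _ := Group.on T.
HB.instance Definition _ := hasNbhs.Build T principal_filter.
HB.instance Definition _ := Discrete_ofNbhs.Build T erefl.

Lemma discrete_nbhs (x : T) (A : set T) : A x -> nbhs x A.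
Proof. by move=> Ax; rewrite nbhs_principalE; exact/principal_filterP. Qed.

Lemma discrete_open (A : set T) : open A.
Proof. by rewrite openE => x Ax; exact: discrete_nbhs. Qed.

Lemma discrete_mulg_continuous : continuous (fun xy : T * T => xy.1 * xy.2).
Proof.
move=> [x y] A /= nA; exists ([set x], [set y]) => /=.
  by split; exact: discrete_nbhs.
by move=> [_ _] /= [-> ->]; exact: nbhs_singleton nA.
Qed.

Lemma discrete_invg_continuous : continuous (fun x : T => x^-1).
Proof.
by move=> x A /= nA; apply: discrete_nbhs; exact: nbhs_singleton nA.
Qed.

HB.instance Definition _ :=
  isTopologicalGroup.Build T discrete_mulg_continuous discrete_invg_continuous.

Lemma card_eq_finset (S : finType) (A : {set S}) : ([set` A] #= `I_#|A|)%card.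
Proof.
have -> : [set` A] = [set` [fset x in A]%fset].
  by apply/seteqP; split=> x /=; rewrite !inE.
by apply/card_eq_fsetP; rewrite card_finset.
Qed.

Lemma discrete_pro_p (p : nat) : p.-group [set: Q]%SET -> pro_p p T.
Proof.
move=> Qp; split.
- by apply: finite_compact; exact: (@finite_finset Q setT).
- by apply: discrete_hausdorff.
- move=> U /nbhs_singleton U1; exists [set 1]; split; first exact: discrete_open.
    by split; [exact: subgroup_set1|move=> x g ->; rewrite /= conj1g].
  by move=> _ ->.
move=> N _ [Ng _].
have [H HP] := @image_group T Q id N (fun _ _ => erefl) Ng.
have : p.-nat #|[set: Q]%SET : H| by apply: pnat_dvd Qp; exact: dvdn_indexg.
case/p_natP => k ek; exists k; rewrite -ek -card_lcosets.
apply: card_eq_trans (card_eq_finset _); rewrite card_eq_sym.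
have -> : Defs.lcosets N = (fun C : {set Q} => [set` C]) @` [set` fingroup.lcosets H [set: Q]%SET].
  have e x : [set x * y | y in N] = [set` (x *: H)%g].
    apply/seteqP; split=> [_ [y Ny <-]|y /= /lcosetP[a /HP[b Nb <-] ->]]; last by exists b.
    by apply/lcosetP; exists y => //; apply/HP; exists y.
  apply/seteqP; split=> [_ [x _ <-]|_ [_ /= /lcosetsP[x _ ->] <-]]; last by exists x; rewrite ?e.
  by exists (x *: H)%g => //=; apply/lcosetsP; exists x; rewrite ?inE.
rewrite card_eq_sym; apply: inj_card_eq => A B _ _ /seteqP[AB BA].
by apply/setP => x; apply/idP/idP; [exact: AB|exact: BA].
Qed.

End Discrete.

Section FreeGroups.
Local Open Scope classical_set_scope.
Local Open Scope group_scope.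
Variables (p : nat) (F : free_sigma_system p).
Hypothesis p_pr : prime p.

Lemma free_pro_pP n : pro_p p (F n).
Proof. by case: (free_groupP F n). Qed.

Lemma free_hom (H : topGroupType) n (y : 'I_n -> H) : pro_p p H ->
  exists f : F n -> H, [/\ continuous f, {morph f : a b / a * b} &
    forall i, f (free_gen F i) = y i].
Proof. by move=> HP; case: (free_groupP F n) => _ /(_ H y HP)[f []]; exists f. Qed.

Lemma free_hom_uniq (H : topGroupType) n (f g : F n -> H) : pro_p p H ->
  continuous f -> {morph f : a b / a * b} ->
  continuous g -> {morph g : a b / a * b} ->
  (forall i, f (free_gen F i) = g (free_gen F i)) -> f =1 g.
Proof.
move=> HP fc fM gc gM fg x.
have [_ /(_ H (fun i => f (free_gen F i)) HP)[h [_ huniq]]] := free_groupP F n.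
have <- : h = f by apply: huniq.
by have <- : h = g by apply: huniq; split=> // i; rewrite fg.
Qed.

(** The conjugate of f by sigma agrees with f on the generators, both sides being inverted there, so
    uniqueness makes f equivariant. *)
Lemma free_sigma_hom (H : sigmaGroupType) n (y : 'I_n -> H) : pro_p p H ->
  (forall i, minus_part H (y i)) ->
  exists f : F n -> H, [/\ continuous f, {morph f : a b / a * b},
    {morph f : a / sigma a} & forall i, f (free_gen F i) = y i].
Proof.
move=> HP ym; have [f [fc fM fE]] := free_hom y HP; exists f; split=> //.
suff e : sigma \o f \o sigma =1 f by move=> x; rewrite -[in LHS]e /= !sigmaK.
apply: free_hom_uniq => // [x|x z|i].
- apply: continuous_comp; first exact: sigma_continuous.
  by apply: continuous_comp; [exact: fc|exact: sigma_continuous].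
- by rewrite /= sigmaM fM sigmaM.
- by rewrite /= free_gen_sigma (morphV_of fM) sigmaV fE ym invgK.
Qed.

(** Let B be generated by the x_i together with p-th powers and commutators; the commutators make B
    normal. The projection to the quotient by B and the trivial map agree on the x_i, so uniqueness
    makes the quotient trivial, and the Frattini argument discards the powers and commutators. *)
Lemma free_gen_generate n (K : set (F n)) : closed K -> subgroup_set K ->
  (forall i, K (free_gen F i)) -> K = setT.
Proof.
move=> Kc Kg Kx; pose X := range (@free_gen _ F n).
suff eX : closed_gen X = setT.
  apply/seteqP; split=> // x _; have : closed_gen X x by rewrite eX.
  by apply: closed_gen_sub => // _ [i _ <-].
apply: (frattini_gen p_pr (free_pro_pP n) (@closed_gen_closed _ X) (closed_gen_subgroup X)).
set A := _ `|` _.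
have [A1 AM AV] := closed_gen_subgroup A.
have An : normal_set (closed_gen A).
  split; first by split.
  move=> x g Ax; have -> : x ^ g = x * [~ x, g] by rewrite commgEl mulgA mulgV mul1g.
  by apply: AM => //; apply: sub_closed_gen; right; right; exists x, g.
have As x : closed_gen A x -> closed_gen A (sigma x).
  apply: closed_gen_map; [exact: sigma_continuous|exact: sigmaM|].
  move=> {}x [Xx|[[y _ <-]|[y [g [_ ->]]]]].
  - apply: sub_closed_gen; left; move: Xx.
    apply: closed_gen_map; [exact: sigma_continuous|exact: sigmaM|].
    move=> _ [i _ <-]; rewrite free_gen_sigma.
    have [_ _ XV] := closed_gen_subgroup X.
    by apply: XV; apply: sub_closed_gen; exists i.
  - apply: sub_closed_gen; right; left; exists (sigma y) => //.
    by rewrite (morphX_of (@sigmaM _)).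
  - apply: sub_closed_gen; right; right; exists (sigma y), (sigma g); split=> //.
    by rewrite (morphR_of (@sigmaM _)).
pose B := SigmaNormal An As.
have QP : pro_p p (quot B).
  by apply: pro_p_quot (free_pro_pP n); exact: closed_gen_closed.
apply/seteqP; split=> // x _.
suff : quot_pi B x = 1 by move/quot_pi_eq1.
apply: (@free_hom_uniq _ _ (quot_pi B) (fun=> 1) QP) => //.
- exact: quot_pi_continuous.
- exact: quot_pi_morphM.
- exact: cst_continuous.
- by move=> *; rewrite mulg1.
move=> i; apply/quot_pi_eq1; apply: sub_closed_gen; left; apply: sub_closed_gen.
by exists i.
Qed.

End FreeGroups.

Section MinusAndKernels.
Local Open Scope classical_set_scope.
Local Open Scope group_scope.

Definition mk_minus (G : sigmaGroupType) (x : G) (xm : minus_part G x) : minus_borel G :=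
  exist _ x (mem_set xm).

Definition full_normal (G : sigmaGroupType) : sigmaNormal G.
Proof. by apply: (@SigmaNormal G setT) => //; split=> //; split. Defined.

Section Kernel.
Variables (G H : sigmaGroupType) (f : G -> H).
Hypotheses (fM : {morph f : x y / x * y}) (fs : {morph f : x / sigma x}).

Lemma kernel_normal : normal_set [set x | f x = 1].
Proof.
split; first split=> /=.
- exact: morph1_of.
- by move=> x y fx fy; rewrite fM fx fy mulg1.
- by move=> x fx; rewrite (morphV_of fM) fx invg1.
- by move=> x g fx; rewrite /= (morphJ_of fM) fx conj1g.
Qed.

Lemma kernel_sigma x : [set x | f x = 1] x -> [set x | f x = 1] (sigma x).
Proof. by move=> /= fx; rewrite fs fx sigma1. Qed.

Definition kernelN : sigmaNormal G := SigmaNormal kernel_normal kernel_sigma.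

Lemma kernel_open : finite_set [set: H] -> hausdorff_space H -> continuous f ->
  open (normal_carrier kernelN).
Proof.
move=> Hfin Hh fc; apply: (@open_comp _ _ f [set 1]) => [x _|]; first exact: fc.
exact: finite_hausdorff_open.
Qed.

End Kernel.
End MinusAndKernels.

(** * Gaschuetz lifting inside the minus part *)

Section Lifting.
Local Open Scope classical_set_scope.
Local Open Scope group_scope.
Variables (p : nat) (F : free_sigma_system p) (n : nat).
Hypotheses (p_pr : prime p) (p_gt2 : (2 < p)%N).

Local Notation Fn := (F n).
Local Notation FP := (free_pro_pP F n).

(** The free generators in the role of relators: their normal closure is F_n itself, so the
    finiteness results on N / N^p [N, F_n] also cover N = F_n and yield the Frattini quotient of
    F_n. *)
Definition free_gen_tuple : n.-tuple (minus_borel Fn) :=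
  [tuple mk_minus (free_gen_sigma F i) | i < n].

Lemma closed_gen_free_gen : normal_carrier (full_normal Fn) = closed_gen (relators free_gen_tuple).
Proof.
apply/esym/(free_gen_generate p_pr); [exact: closed_gen_closed|exact: closed_gen_subgroup|].
move=> i; apply: sub_closed_gen; exists i, 1; rewrite conjg1.
by rewrite tnth_mktuple.
Qed.

Lemma full_open : open (normal_carrier (full_normal Fn)).
Proof. exact: openT. Qed.

Lemma full_frattini_open : open (normal_carrier (frattiniN p (full_normal Fn))).
Proof. exact: (frattiniN_open (prime_gt0 p_pr) closed_gen_free_gen FP full_open). Qed.

Local Notation q := (frattini_proj FP full_frattini_open).
Local Notation X := (fin_copy (finite_quot FP full_frattini_open)).
Local Notation V := (frattini_image FP full_frattini_open).

Let qM : {morph q : x y / x * y} := frattini_projM FP full_frattini_open.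

Lemma free_frattini_image x : q x \in V.
Proof. by apply/(mem_frattini_image FP full_open). Qed.

Lemma free_frattini_abelem : p.-abelem V.
Proof. exact: frattini_image_abelem. Qed.

Lemma free_frattiniC x y : commute (q x) (q y).
Proof. exact: frattini_image_central (free_frattini_image x). Qed.

(** The Frattini quotient is abelian, so inversion is a homomorphism there and the equality holds on
    a closed subgroup; that subgroup contains the x_i. *)
Lemma free_frattini_sigma x : q (sigma x) = (q x)^-1.
Proof.
suff : [set x | q (sigma x) = (q x)^-1] = setT by move/seteqP => -[_ /(_ x)]; exact.
have [Mg _] := normal_carrierP (frattiniN p (full_normal Fn)).
apply: (free_gen_generate p_pr).
- apply: (proj2 (clopen_translates full_frattini_open Mg _)) => y z Myz /=.
  have e1 : q y = q z by apply/quot_pi_eq.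
  have e2 : q (sigma y) = q (sigma z).
    by apply/quot_pi_eq; rewrite -sigmaV -sigmaM; exact: normal_carrier_sigma.
  by rewrite -e1 -e2.
- split=> /=.
  + by rewrite sigma1 (morph1_of qM) invg1.
  + by move=> y z ey ez; rewrite sigmaM !qM invgM ey ez -!ey -!ez; exact: free_frattiniC.
  + by move=> y ey; rewrite sigmaV !(morphV_of qM) ey.
- by move=> i /=; rewrite free_gen_sigma (morphV_of qM).
Qed.

Lemma card_free_frattini : (#|V| <= p ^ n)%N.
Proof.
have [/(_ (esym closed_gen_free_gen)) [Vl <-] _] :=
  closed_gen_relators_eq p_pr FP full_open full_frattini_open free_gen_tuple.
apply: leq_trans (card_gen_seq p_pr free_frattini_abelem Vl) _.
by rewrite size_map size_tuple.
Qed.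

(** For odd p squaring is invertible on a group of exponent p: raising to the power (p+1)/2 undoes
    it. *)
Lemma free_frattini_sqrt (W : {group X}) x : q x ^+ 2 \in W -> q x \in W.
Proof.
move=> Wx2.
have p_odd : odd p by case: (even_prime p_pr) p_gt2 => [->|].
have := groupX (p.+1)./2 Wx2; rewrite -expgM mul2n halfK /= p_odd /= subn0 expgS.
have [_ Vp] := abelemP p_pr free_frattini_abelem.
by rewrite (Vp _ (free_frattini_image x)) mulg1.
Qed.

Section Lifts.
Variables (G : sigmaGroupType) (f : Fn -> G).
Hypotheses (fM : {morph f : x y / x * y}) (fs : {morph f : x / sigma x}).
Hypothesis minus_surj : forall g, minus_part G g -> exists2 w, minus_part Fn w & f w = g.

Local Notation span ws := <<[set y in [seq q w | w <- ws]]%SET>>.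

(* Each generator is lifted outside the span of the previous lifts whenever that is
   possible; when it is not, the span already contains the image of the kernel. *)
Lemma greedy_lifts (hs : seq G) : (forall h, h \in hs -> minus_part G h) ->
  exists ws : seq Fn, [/\ forall w, w \in ws -> minus_part Fn w, [seq f w | w <- ws] = hs &
    (forall x, f x = 1 -> q x \in span ws) \/ (p ^ size hs <= #|span ws|)%N].
Proof.
elim: hs => [_|h hs IH hm].
  exists [::]; split=> //; right; rewrite expn0; exact: cardG_gt0.
have [x xhs|ws [wm wE wspan]] := IH; first by apply: hm; rewrite inE xhs orbT.
have hm1 : minus_part G h by apply: hm; exact: mem_head.
have Vws : all (mem V) [seq q w | w <- ws].
  by apply/allP => _ /mapP[w _ ->]; exact: free_frattini_image.
have ext w : minus_part Fn w -> f w = h ->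
    (forall v, v \in w :: ws -> minus_part Fn v) /\ [seq f v | v <- w :: ws] = h :: hs.
  move=> wmin fw; split=> /=; last by rewrite fw wE.
  by move=> v; rewrite inE => /orP[/eqP->|/wm].
have sub w : span ws \subset span (w :: ws).
  by apply: genS; apply/fintype.subsetP => y; rewrite !inE => ->; rewrite orbT.
have [w0 w0m fw0] := minus_surj hm1.
case: wspan => [Kws|cws].
  exists (w0 :: ws); have [? ?] := ext _ w0m fw0; split=> //; left=> x /Kws.
  exact: (fintype.subsetP (sub w0)).
have [[w [wmin fw qw]]|nw] := pselect (exists w, [/\ minus_part Fn w, f w = h & q w \notin span ws]).
  exists (w :: ws); have [? ?] := ext _ wmin fw; split=> //; right.
  rewrite [[seq q _ | _ <- _]]/= (card_gen_cons p_pr free_frattini_abelem) //;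
    last exact: free_frattini_image.
  by rewrite (negbTE qw) /= expnS leq_mul2l cws orbT.
have inW w : minus_part Fn w -> f w = h -> q w \in span ws.
  by move=> wmin fw; apply: contrapT => /negP qw; apply: nw; exists w.
exists (w0 :: ws); have [? ?] := ext _ w0m fw0; split=> //; left=> u fu.
(* For u in the kernel, t = u sigma(u)^-1 is in the kernel and in F_n^-, so t w0 t is again a minus
   lift of h and q sends it to q(w0) q(u)^4. By [inW] both q(w0) and this product lie in the span;
   two square roots give q(u). *)
apply: (fintype.subsetP (sub w0)); apply: free_frattini_sqrt; rewrite -(morphX_of qM).
apply: free_frattini_sqrt; rewrite (morphX_of qM).
pose t := u * (sigma u)^-1.
have qt : q t = q u ^+ 2.
  by rewrite qM (morphV_of qM) free_frattini_sigma invgK -expg2.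
have : q (t * w0 * t) \in span ws.
  apply: inW; rewrite /minus_part /=.
    by rewrite !sigmaM !sigmaV sigmaK w0m !invgM !invgK !mulgA.
  by rewrite !fM !(morphV_of fM) !fs fu sigma1 invg1 !mulg1 mul1g.
rewrite (qM (t * w0)) (qM t w0) (free_frattiniC t w0) -mulgA -expg2.
by rewrite (groupMl _ (inW w0 w0m fw0)) qt.
Qed.

End Lifts.
End Lifting.

Section KernelPresentation.
Local Open Scope classical_set_scope.
Local Open Scope group_scope.
Variables (p : nat) (F : free_sigma_system p) (n : nat).
Hypotheses (p_pr : prime p) (p_gt2 : (2 < p)%N).
Local Notation Fn := (F n).
Local Notation FP := (free_pro_pP F n).
Variables (G : sigmaGroupType) (f : Fn -> G).
Hypotheses (GP : pro_p p G) (Gfin : finite_set [set: G]) (fc : continuous f).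
Hypotheses (fM : {morph f : x y / x * y}) (fs : {morph f : x / sigma x}).
Hypothesis minus_surj : forall g, minus_part G g -> exists2 w, minus_part Fn w & f w = g.

Local Notation q := (frattini_proj FP (full_frattini_open F n p_pr)).

(** Both alternatives of [greedy_lifts] make the span the whole Frattini quotient: either it
    contains the image of the kernel while the lifts hit generators of G, or its order reaches the
    bound p^n. The Frattini argument then gives generation of F_n. *)
Lemma lift_generators (hs : seq G) : size hs = n ->
  (forall h, h \in hs -> minus_part G h) ->
  (forall K : set G, subgroup_set K -> (forall h, h \in hs -> K h) -> K = setT) ->
  exists ws : seq Fn, [/\ forall w, w \in ws -> minus_part Fn w, [seq f w | w <- ws] = hs &
    forall K : set Fn, closed K -> subgroup_set K -> (forall w, w \in ws -> K w) -> K = setT].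
Proof.
move=> sz hm hgen.
have [ws [wm wE wspan]] := greedy_lifts p_pr p_gt2 fM fs minus_surj hm.
exists ws; split=> // K Kc Kg Kws.
have qM : {morph q : x y / x * y} := frattini_projM FP _.
pose V := frattini_image FP (full_frattini_open F n p_pr).
have Vws : all (mem V) [seq q w | w <- ws].
  by apply/allP => _ /mapP[w _ ->]; exact: free_frattini_image.
have span x : q x \in <<[set y in [seq q w | w <- ws]]%SET>>.
  case: wspan => [Kspan|].
    (* L is a subgroup of G containing hs, hence all of G. So x differs from some y with q y in the
       span by an element of the kernel of f, whose image is in the span as well. *)
    pose L := [set g | exists2 y, q y \in <<[set y in [seq q w | w <- ws]]%SET>> & f y = g].
    have : L = setT.
      apply: hgen; first split.
      - by exists 1; rewrite ?(morph1_of fM) // (morph1_of qM) group1.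
      - by move=> _ _ [a aL <-] [b bL <-]; exists (a * b); rewrite // qM groupM.
      - by move=> _ [a aL <-]; exists a^-1; rewrite ?(morphV_of fM) // (morphV_of qM) groupV.
      move=> h; rewrite -wE => /mapP[w ww ->]; exists w => //.
      by apply: mem_gen; rewrite inE; exact: map_f.
    move/seteqP => -[_ /(_ (f x) I)] [y yL fy].
    have /Kspan : f (y^-1 * x) = 1 by rewrite fM (morphV_of fM) fy mulVg.
    by rewrite qM (morphV_of qM) groupMl ?groupV.
  rewrite sz => le; have e : <<[set y in [seq q w | w <- ws]]%SET>> = V.
    apply/eqP; rewrite finset.eqEcard gen_seq_sub //=.
    exact: leq_trans (card_free_frattini F n p_pr) le.
  by rewrite e; exact: free_frattini_image.
apply: (frattini_gen p_pr FP Kc Kg); apply/seteqP; split=> // x _.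
have [K' K'P] := image_group qM Kg.
have : q x \in K'.
  move: (span x); apply/fintype.subsetP; rewrite gen_subG; apply/fintype.subsetP => y.
  by rewrite inE => /mapP[w ww ->]; apply/K'P; exists w => //; exact: Kws.
case/K'P => a Ka /quot_pi_eq Max.
have [_ CM _] := closed_gen_subgroup (K `|` frattini_gens p setT).
rewrite -[x](mul1g x) -(mulgV a) -mulgA; apply: CM.
  by apply: sub_closed_gen; left.
by apply: closed_genS Max => y; right.
Qed.

Variables (m : nat) (g : F m -> G) (r : m.-tuple (minus_borel (F m))).
Hypotheses (gc : continuous g) (gM : {morph g : x y / x * y})
  (gs : {morph g : x / sigma x}) (g_surj : forall y, exists x, g x = y).
Hypothesis ker_g : forall x, g x = 1 <-> closed_gen (relators r) x.
Hypothesis mn : (m <= n)%N.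

Lemma kernel_presentation : exists s : n.-tuple (minus_borel Fn),
  normal_carrier (kernelN fM fs) = closed_gen (relators s).
Proof.
pose h (i : 'I_n) : G := if insub (val i) is Some j then g (free_gen F (j : 'I_m)) else 1.
have hm i : minus_part G (h i).
  rewrite /h; case: insubP => [j _ _|_]; last exact: minus1.
  by rewrite /minus_part /= -gs free_gen_sigma (morphV_of gM).
have hE (j : 'I_m) : h (widen_ord mn j) = g (free_gen F j).
  by rewrite /h (insubT (fun k => k < m)%N (ltn_ord j)); congr (g (free_gen F _)); exact: val_inj.
have clG (K : set G) : closed K.
  have [_ Gh _ _] := GP; rewrite -[K]setCK; apply: open_closedC.
  exact: finite_hausdorff_open.
have [|||ws [wm wE wgen]] := @lift_generators [tuple h i | i < n].
- by rewrite size_tuple.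
- by move=> _ /tnthP[i ->]; rewrite tnth_mktuple.
- move=> K [K1 KM KV] Kh; apply/seteqP; split=> // y _.
  have [x <-] := g_surj y.
  suff /seteqP[_ /(_ x I)] : [set x | K (g x)] = setT by [].
  apply: (free_gen_generate p_pr).
  + by apply: (@preimage_closed _ _ g) => // z _; exact: gc.
  + exact: subgroup_preim.
  + move=> j /=; rewrite -hE; apply: Kh.
    by rewrite -(tnth_mktuple h (widen_ord mn j)) mem_tnth.
have sz : size ws = n by rewrite -(size_map f) wE size_tuple.
pose w (i : 'I_n) := nth 1 ws i.
have wws i : w i \in ws by rewrite mem_nth // sz.
have fw i : f (w i) = h i.
  by rewrite -(tnth_mktuple h i) (tnth_nth 1) -wE (nth_map 1) ?sz.
have [j [jc jM js jE]] := @free_sigma_hom p F Fn m (fun i => w (widen_ord mn i)) FP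
  (fun i => wm _ (wws _)).
have fj : f \o j =1 g.
  apply: free_hom_uniq GP _ _ gc gM _.
  - by move=> x; apply: continuous_comp; [exact: jc|exact: fc].
  - exact: morph_comp.
  - by move=> i /=; rewrite jE fw hE.
pose v (i : 'I_n) := if insub (val i) is Some k then j (minus_val (tnth r (k : 'I_m))) else w i.
have vm i : minus_part Fn (v i).
  rewrite /v; case: insubP => [k _ _|_]; last exact/wm/wws.
  by rewrite /minus_part /= -js (minus_valP (tnth r k)) (morphV_of jM).
pose s := [tuple mk_minus (vm i) | i < n].
have sE i : minus_val (tnth s i) = v i by rewrite tnth_mktuple.
exists s; have [Lg LJ] := relators_normal s; have [L1 LM LV] := Lg.
have [[K1 KM KV] KJ] := kernel_normal fM.
have jL x : closed_gen (relators r) x -> closed_gen (relators s) (j x).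
  apply: closed_gen_map => // _ [i [y ->]]; apply: sub_closed_gen.
  exists (widen_ord mn i), (j y); rewrite (morphJ_of jM) sE /v.
  rewrite (insubT (fun k => k < m)%N (ltn_ord i)); congr (j (minus_val (tnth r _)) ^ _).
  exact: val_inj.
have Lw i : ~~ (val i < m)%N -> closed_gen (relators s) (w i).
  move=> im; apply: sub_closed_gen; exists i, 1; rewrite conjg1 sE /v.
  by case: insubP => // k ki; rewrite ki in im.
have Lker : closed_gen (relators s) `<=` [set x | f x = 1].
  apply: closed_gen_sub => [||_ [i [y ->]]].
  - by apply: (@preimage_closed _ _ f [set 1]) => // z _; exact: fc.
  - by split.
  - apply: KJ; rewrite sE /v /=; case: insubP => [k _ _|im]; last first.
      by rewrite fw /h; case: insubP => // k ki; rewrite ki in im.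
    rewrite -[LHS]/((f \o j) _) fj; apply/ker_g.
    by apply: sub_closed_gen; exists k, 1; rewrite conjg1.
apply/seteqP; split=> [x fx|]; last exact: Lker.
(* F_n = j(F_m) L with L the normal closure of s: the product is a subgroup containing every w_i,
   and it is closed as the image of a compact set. For x = j(u) l in the kernel, g(u) = 1, so u lies
   in the normal closure of r and j(u) in L. *)
have : [set x | exists u l, closed_gen (relators s) l /\ x = j u * l] = setT.
  have [mc mh _ _] := free_pro_pP F m; have [nc nh _ _] := FP.
  apply: wgen; last first.
  - move=> w1 /(nthP 1)[i]; rewrite sz => i_n <-.
    rewrite -/(w (Ordinal i_n)).
    have [im|im] := ltnP i m; last first.
      exists 1, (w (Ordinal i_n)); split; last by rewrite (morph1_of jM) mul1g.
      by apply: Lw; rewrite -leqNgt.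
    exists (free_gen F (Ordinal im)), 1; split=> //.
    by rewrite jE mulg1; congr w; exact: val_inj.
  - split.
    + by exists 1, 1; rewrite (morph1_of jM) mulg1.
    + move=> _ _ [a [l [Ll ->]]] [b [k [Lk ->]]].
      exists (a * b), (l ^ j b * k); split; first by apply: LM => //; exact: LJ.
      by rewrite jM /conjg !mulgA mulgK.
    + move=> _ [a [l [Ll ->]]]; exists a^-1, ((l^-1) ^ (j a)^-1); split; first by apply: LJ;
      exact: LV.
      by rewrite (morphV_of jM) /conjg invgK invgM !mulgA mulVg mul1g.
  - apply: compact_closed => //.
    have -> : [set x | exists u l, closed_gen (relators s) l /\ x = j u * l] =
        (fun ul : F m * Fn => j ul.1 * ul.2) @` (setT `*` closed_gen (relators s)).
      apply/seteqP; split=> [_ [u [l [Ll ->]]]|_ [[u l] [_ Ll] <-]]; first by exists (u, l).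
      by exists u, l.
    apply: continuous_compact; last first.
      apply: compact_setX => //; apply: subclosed_compact nc _ => //.
      exact: closed_gen_closed.
    apply: continuous_subspaceT => ul.
    apply: (@continuous_comp _ _ _ (fun ul : F m * Fn => (j ul.1, ul.2)) (fun xy => xy.1 * xy.2)).
      apply: cvg_pair; last exact: cvg_snd.
      by apply: (@continuous_comp _ _ _ fst j); [exact: cvg_fst|exact: jc].
    exact: mulg_continuous.
move/seteqP => -[_ /(_ x I)] [u [l [Ll xE]]]; rewrite xE; apply: LM => //; apply: jL.
have fl := Lker _ Ll.
by apply/ker_g; rewrite -fj /=; move: fx; rewrite /= xE fM fl mulg1.
Qed.

End KernelPresentation.

Lemma mul_fun_continuous (T : topologicalType) (H : topGroupType) (a b : T -> H) :
  continuous a -> continuous b -> continuous (fun x => (a x * b x)%g).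
Proof.
move=> ac bc x.
apply: (@continuous_comp _ _ _ (fun x => (a x, b x)) (fun xy => (xy.1 * xy.2)%g)).
  by apply: cvg_pair; [exact: ac|exact: bc].
exact: mulg_continuous.
Qed.

(** * Lifting minus elements by means of the Haar measure *)

Section HaarSurjective.
Local Open Scope classical_set_scope.
Local Open Scope group_scope.
Variables (R : realType) (p : nat) (G : sigmaGroupType).
Hypothesis GP : pro_p p G.
Variable mu : probability (minus_borel G) R.
Hypothesis muP : is_haar mu.

(** An empty fiber would have measure 0, whereas [is_haar] prescribes the inverse of a positive
    integer. *)
Lemma haar_minus_surj (N : sigmaNormal G) (y : quot N) : open (normal_carrier N) ->
  minus_part (quot N) y -> exists2 w, minus_part G w & quot_pi N w = y.
Proof.
move=> No ym; have e := muP No ym; apply: contrapT => nw.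
have e0 : [set a | quot_pi N (minus_val a) = y] = set0.
  apply/seteqP; split=> // a ay; apply: nw; exists (minus_val a) => //.
  exact: minus_valP.
move: e; rewrite e0 measure0 => /esym/eqP; rewrite eqe GRing.invr_eq0 Num.Theory.pnatr_eq0.
have Qfin := finite_quot GP No.
rewrite (card_fin_copy Qfin) => /eqP/card0_eq/(_ (y : fin_copy Qfin)).
by rewrite inE => /asboolP.
Qed.

Lemma haar_minus_lift (H : sigmaGroupType) (f : G -> H) : pro_p p H ->
  finite_set [set: H] -> continuous f -> {morph f : x y / x * y} ->
  {morph f : x / sigma x} -> (forall y, exists x, f x = y) ->
  forall h, minus_part H h -> exists2 w, minus_part G w & f w = h.
Proof.
move=> [_ Hh _ _] Hfin fc fM fs f_surj h hm.
have No := kernel_open fM fs Hfin Hh fc.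
have [x fx] := f_surj h.
have [|w wm] := @haar_minus_surj (kernelN fM fs) (quot_pi _ x) No.
  rewrite /minus_part /= -quot_pi_morph_sigma -(morphV_of (@quot_pi_morphM _ _)).
  by apply/quot_pi_eq; rewrite /= fM !(morphV_of fM) fs fx hm invgK mulgV.
move=> /quot_pi_eq /= e; exists w => //; rewrite -fx -[RHS]mul1g -(mulgV (f w)) -mulgA.
by rewrite -(morphV_of fM) -fM e mulg1.
Qed.

End HaarSurjective.

(** * The lower bound for the rank of N / N^p [N, F_n] *)

Section FrattiniRank.
Local Open Scope classical_set_scope.
Local Open Scope group_scope.
Variables (p : nat) (F : free_sigma_system p) (n : nat).
Hypothesis p_pr : prime p.
Local Notation Fn := (F n).
Local Notation FP := (free_pro_pP F n).
Variables (N : sigmaNormal Fn) (No : open (normal_carrier N))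
  (Mo : open (normal_carrier (frattiniN p N))).
Local Notation V := (frattini_image FP Mo).
Local Notation q := (frattini_proj FP Mo).

(* Otherwise [N] would be the normal closure of fewer than [n] elements, and
   [F_n / N] would have more homomorphisms to [Z / p ^ s] than a finite group
   of its order allows. *)
Lemma frattini_rank_lower k : #|V| = (p ^ k)%N ->
  (forall v, v \in V -> exists2 w, minus_part Fn w & q w = v) -> (n <= k)%N.
Proof.
move=> cV lift; rewrite leqNgt; apply/negP => kn.
have [t [Vt genV]] := exists_free_generators p_pr (frattini_image_abelem p_pr FP Mo) cV.
have rw (i : 'I_k) : exists a : minus_borel Fn, q (minus_val a) = tnth t i.
  have [w wm qw] := lift _ (allP Vt _ (mem_tnth i t)).
  by exists (mk_minus wm).
pose r := [tuple projT1 (cid (rw i)) | i < k].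
have er : [seq q (minus_val a) | a <- r] = t.
  apply: (congr1 val (_ : map_tuple (fun a => q (minus_val a)) r = t)).
  by apply: eq_from_tnth => i; rewrite tnth_map tnth_mktuple; case: (cid (rw i)).
have Nr : closed_gen (relators r) = normal_carrier N.
  by apply/(closed_gen_relators_eq p_pr FP No Mo); rewrite er.
have /p_natP[e ce] := pgroup_quot FP p_pr No.
have Ne x : normal_carrier N (x ^+ (p ^ e)).
  apply/quot_pi_eq1; rewrite (morphX_of (@quot_pi_morphM _ _)) -ce.
  exact: (@expg_cardG (fin_copy (finite_quot FP No)) [set: _]%G (quot_pi N x) (finset.in_setT _)).
(* The injection below gives p^((s-e)n) <= p^(sk). With k <= n - 1 this forces s <= e n, so e n + 1
   is contradictory. *)
pose s := (e * n).+1.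
have q_gt1 : (1 < p ^ s)%N by rewrite -(exp1n s) ltn_exp2r // prime_gt1.
pose Z := discrete_group 'Z_(p ^ s).
have ZP : pro_p p Z.
  apply: discrete_pro_p; rewrite /pgroup cardsT card_ord Zp_cast //.
  by rewrite pnatX pnat_id.
(* Values are restricted to representatives below p^(s-e), so that multiplying them by p^e involves
   no reduction modulo p^s. *)
have hom (y : {ffun 'I_n -> 'I_(p ^ (s - e))}) := cid (free_hom F (fun i => (y i)%:R%R : Z) ZP).
pose Psi y : {ffun 'I_k -> 'Z_(p ^ s)} := [ffun i => projT1 (hom y) (minus_val (tnth r i))].
(* If two homomorphisms agree on the relators, their difference d vanishes on N, which contains each
   x_i^(p^e). Hence p^e y_i = p^e y'_i, first modulo p^s and then as integers. *)
have Psi_inj : injective Psi.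
  move=> y y' /ffunP eP; apply/ffunP => i; apply: val_inj.
  have {}eP k' : projT1 (hom y) (minus_val (tnth r k')) = projT1 (hom y') (minus_val (tnth r k')).
    by have := eP k'; rewrite !ffunE.
  case: (hom y) (hom y') eP => f [fc fM fE] [g [gc gM gE]] /= eP.
  pose d x : Z := f x * (g x)^-1.
  have dM : {morph d : a b / a * b}.
    move=> a b; rewrite /d fM gM invgM -!mulgA; congr (_ * _).
    by rewrite mulgA; exact: Zp_mulgC.
  have dc : continuous d.
    apply: (@mul_fun_continuous _ Z f (fun x => (g x)^-1) fc) => x.
    by apply: (@continuous_comp _ _ _ g (fun z : Z => z^-1)); [exact: gc|exact: invg_continuous].
  have dN x : normal_carrier N x -> d x = 1.
    rewrite -Nr; apply: (@closed_gen_sub _ _ [set x | d x = 1]).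
    - apply: (@preimage_closed _ _ d [set 1]) => [z _|]; first exact: dc.
      by rewrite -[X in closed X]setCK; apply: open_closedC; exact: discrete_open.
    - by apply: (subgroup_preim (P := fun z => z = 1) dM) => // [a b -> ->|a ->];
      rewrite ?mulg1 ?invg1.
    - by move=> _ [j [x' ->]] /=; rewrite (morphJ_of dM) /d eP mulgV conj1g.
  have : f (free_gen F i ^+ (p ^ e)) = g (free_gen F i ^+ (p ^ e)).
    by apply: (mulIg (g (free_gen F i ^+ (p ^ e)))^-1); rewrite mulgV; exact: dN (Ne _).
  rewrite (morphX_of fM) (morphX_of gM) fE gE.
  rewrite -[LHS]/(((y i)%:R *+ p ^ e)%R : 'Z_(p ^ s)) -[RHS]/(((y' i)%:R *+ p ^ e)%R : 'Z_(p ^ s)).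
  rewrite -!GRing.mulrnA => /(congr1 (@nat_of_ord _)).
  have es : (e <= s)%N by rewrite /s; nia.
  have bound (a : 'I_(p ^ (s - e))) : (a * p ^ e < p ^ s)%N.
    by rewrite -[X in (_ < p ^ X)%N](@subnK e s) ?expnD ?ltn_pmul2r ?expn_gt0 ?prime_gt0.
  rewrite !val_Zp_nat // !modn_small ?bound // => /eqP.
  by rewrite eqn_pmul2r ?expn_gt0 ?prime_gt0 // => /eqP.
have := leq_card Psi Psi_inj; rewrite !card_ffun !card_ord Zp_cast // -!expnM.
rewrite leq_exp2l ?prime_gt1 // /s; nia.
Qed.
End FrattiniRank.

Import Order.TTheory GRing.Theory Num.Theory.
Import numFieldNormedType.Exports.
Import generic_quotient Defs.

(** * Haar measure of the relator tuples with a given normal closure *)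

Section Multicover.
Local Open Scope classical_set_scope.
Local Open Scope ring_scope.
Local Open Scope ereal_scope.
Context d (T : measurableType d) (R : realType) (mu : {measure set T -> \bar R}).

(** Double counting: a times the indicator of A is the sum of the indicators of the S_i, and both
    sides are integrated. Since a > 0, A is the union of the S_i, whence its measurability. *)
Lemma multicover_measure (I : finType) (S : I -> set T) (A : set T) (a : nat) :
  (0 < a)%N -> (forall i, measurable (S i)) ->
  (forall x, #|[pred i | `[< S i x >]]| = (`[< A x >] * a)%N) ->
  measurable A /\ a%:R%:E * mu A = \sum_(i : I) mu (S i).
Proof.
move=> a_gt0 mS cS.
have AE : A = \bigcup_(i in [set: I]) S i.
  apply/seteqP; split=> x.
    move=> /asboolP Ax; have := cS x; rewrite Ax mul1n => e.
    have : (0 < #|[pred i | `[< S i x >]]|)%N by rewrite e.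
    by move=> /card_gt0P[i Si]; exists i => //; exact/asboolP.
  move=> [i _ Si]; apply/asboolP; apply: contraT => nA.
  have := cS x; rewrite (negbTE nA) mul0n => /card0_eq/(_ i).
  by move=> /negP; case; apply/asboolP.
have mA : measurable A by rewrite AE; apply: fin_bigcup_measurable.
split=> //.
have -> : a%:R%:E * mu A = \int[mu]_(x in setT) (a%:R%:E * (\1_A x)%:E).
  rewrite ge0_integralZl //; first by rewrite integral_indic // setIT.
  by apply/measurable_EFinP; exact: measurable_indic.
transitivity (\int[mu]_(x in setT) \sum_(i <- index_enum I) (\1_(S i) x)%:E).
  apply: eq_integral => x _; rewrite sumEFin -EFinM; congr EFin.
  have -> : (\sum_(i : I) (\1_(S i) x : R) = (#|[pred i | `[< S i x >]]|)%:R)%R.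
    rewrite -sum1_card natr_sum [RHS]big_mkcond /=; apply: eq_bigr => i _.
    rewrite indicE; have -> : (i \in [pred i0 | `[< S i0 x >]]) = (x \in S i).
      by apply/asboolP/idP => [/mem_set|/set_mem].
    by case: ifP.
  rewrite cS indicE natrM mulrC; congr (_%:R * _)%R.
rewrite ge0_integral_sum //.
  by apply: eq_bigr => i _; rewrite integral_indic // setIT.
by move=> i; apply/measurable_EFinP; exact: measurable_indic.
Qed.

End Multicover.

Section FiberMeasure.
Local Open Scope classical_set_scope.
Local Open Scope group_scope.
Variables (R : realType) (p : nat) (F : free_sigma_system p).
Variable haar : forall n, probability (minus_borel (F n)) R.
Hypotheses (p_pr : prime p) (p_gt2 : (2 < p)%N) (haarP : forall n, is_haar (haar n)).
Variables (n : nat) (G : sigmaGroupType) (f : F n -> G).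
Hypotheses (GP : pro_p p G) (Gfin : finite_set [set: G]) (fc : continuous f).
Hypotheses (fM : {morph f : x y / x * y}) (fs : {morph f : x / sigma x}).
Hypothesis f_surj : forall y, exists x, f x = y.
Variable s : n.-tuple (minus_borel (F n)).

Local Notation Fn := (F n).
Local Notation FP := (free_pro_pP F n).
Local Notation N := (kernelN fM fs).
Hypothesis Ns : normal_carrier N = closed_gen (relators s).

Lemma fiber_open : open (normal_carrier N).
Proof. by case: GP => _ Gh _ _; exact: kernel_open. Qed.

Lemma fiber_frattini_open : open (normal_carrier (frattiniN p N)).
Proof. exact: (frattiniN_open (prime_gt0 p_pr) Ns FP fiber_open). Qed.

Local Notation E := (fin_copy (finite_quot FP fiber_frattini_open)).
Local Notation q := (frattini_proj FP fiber_frattini_open).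
Local Notation V := (frattini_image FP fiber_frattini_open).
Let qM : {morph q : x y / x * y} := frattini_projM FP fiber_frattini_open.

Lemma fiber_span : all (mem V) [seq q (minus_val a) | a <- s] /\
  <<[set y in [seq q (minus_val a) | a <- s]]%SET>> = V.
Proof. exact/(closed_gen_relators_eq p_pr FP fiber_open). Qed.

(** In the abelian group V the elements inverted by sigma form a subgroup, and it contains the
    images of the relators s, which generate V. *)
Lemma frattini_image_minus v : v \in V -> minus_part (quot (frattiniN p N)) v.
Proof.
have [Vs spanV] := fiber_span.
pose W : {set E} := [set x in V | `[< minus_part (quot (frattiniN p N)) x >]]%SET.
have WP x : x \in W <-> x \in V /\ minus_part (quot (frattiniN p N)) x.
  by rewrite inE; split=> [/andP[? /asboolP]|[-> /asboolP]].
have gW : group_set W.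
  apply/group_setP; split; first by apply/WP; split; [exact: group1|exact: minus1].
  move=> x y /WP[Vx xm] /WP[Vy ym]; apply/WP; split; first exact: groupM.
  rewrite /minus_part /= sigmaM xm ym -invgM.
  by congr _^-1; exact: frattini_image_central Vy.
suff /fintype.subsetP VW : V \subset W by move=> /VW /WP[].
rewrite -spanV -[W]/(gval (Group gW)) gen_subG; apply/fintype.subsetP => y.
rewrite inE => /mapP[a sa ->]; apply/WP; split; first by apply: (allP Vs); exact: map_f.
by rewrite /minus_part /= -quot_pi_morph_sigma (minus_valP a) (morphV_of (@quot_pi_morphM _ _)).
Qed.

Lemma card_frattini_image : #|V| = (p ^ n)%N.
Proof.
have [Vs spanV] := fiber_span.
have abV := frattini_image_abelem p_pr FP fiber_frattini_open.
have /p_natP[k ck] := abelem_pgroup abV.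
have kn : (k <= n)%N.
  have := card_gen_seq p_pr abV Vs.
  by rewrite spanV ck size_map size_tuple leq_exp2l // prime_gt1.
have nk : (n <= k)%N.
  apply: (frattini_rank_lower p_pr fiber_open ck) => v Vv.
  have [w wm qw] := haar_minus_surj FP (@haarP n) fiber_frattini_open (frattini_image_minus Vv).
  by exists w; [exact: wm|exact: qw].
by rewrite ck; congr (p ^ _)%N; apply/eqP; rewrite eqn_leq kn.
Qed.

(** Every fiber of the map to G^- is a full coset q(w) V with w a minus lift: V is central and
    inverted by sigma, so multiplying q(w) by an element of V stays in the minus part. *)
Lemma card_minus_frattini :
  card_set (minus_part (quot (frattiniN p N))) = (card_set (minus_part G) * p ^ n)%N.
Proof.
rewrite (card_fin_copy Gfin).
pose Em : {set E} := [set x : E | `[< minus_part (quot (frattiniN p N)) x >]]%SET.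
have -> : card_set (minus_part (quot (frattiniN p N))) = #|Em|.
  by rewrite (card_fin_copy (finite_quot FP fiber_frattini_open)); apply: eq_card => x;
    rewrite [RHS]inE.
have EmP x : x \in Em <-> minus_part (quot (frattiniN p N)) x.
  by rewrite inE; split=> /asboolP.
pose psi (x : E) : fin_copy Gfin := f (repr (x : quot (frattiniN p N))).
have psiE x : psi (q x) = f x.
  have /(frattiniN_sub (normal_open_closed fiber_open)) /= := @repr_pi _ (frattiniN p N) x.
  rewrite fM (morphV_of fM) => e.
  by apply: (mulgI (f x)^-1); rewrite mulVg; exact: e.
rewrite -sum1_card (partition_big psi (fun g => `[< minus_part G g >])) /=; last first.
  move=> x /EmP xm; apply/asboolP.
  have {}xm : sigma (x : quot (frattiniN p N)) = (x : quot (frattiniN p N))^-1 := xm.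
  have [y yx] := quot_pi_surj (x : quot (frattiniN p N)).
  have e : q (sigma y) = q y^-1.
    by rewrite (morphV_of qM) -[LHS]/(quot_pi _ _) quot_pi_morph_sigma yx xm -yx.
  rewrite -yx -[quot_pi _ y]/(q y) psiE /minus_part /= -fs -(morphV_of fM) -!psiE.
  by rewrite e.
transitivity (\sum_(g : fin_copy Gfin | `[< minus_part G g >]) #|V|)%N; last first.
  by rewrite sum_nat_const card_frattini_image.
apply: eq_bigr => g /asboolP gm.
have [w wm fw] := haar_minus_lift FP (@haarP n) GP Gfin fc fM fs f_surj gm.
transitivity #|[set x : E | (x \in Em) && (psi x == g)]%SET|; first by rewrite -sum1_card;
  apply: eq_bigl => x; rewrite [RHS]inE.
rewrite -(card_lcoset V (q w)); apply: eq_card => x.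
rewrite mem_lcoset inE.
have [y yx] := quot_pi_surj (x : quot (frattiniN p N)).
have {}yx : q y = x := yx.
have mV : (q w)^-1 * x \in V <-> f y = g.
  rewrite -yx -(morphV_of qM) -qM; split=> [/(mem_frattini_image FP fiber_open)|fy] /=.
    by rewrite fM (morphV_of fM) fw => e; apply: (mulgI g^-1); rewrite e mulVg.
  by apply/(mem_frattini_image FP fiber_open); rewrite /= fM (morphV_of fM) fw fy mulVg.
apply/andP/idP => [[_ /eqP]|Vx].
  by rewrite -yx psiE => /mV; rewrite yx.
split; last by rewrite -yx psiE; apply/eqP/mV.
apply/EmP; have vm := frattini_image_minus Vx.
have aC : commute ((q w)^-1 * x) (q w) := frattini_image_central (q w) Vx.
have am : sigma (quot_pi (frattiniN p N) w) = (quot_pi (frattiniN p N) w)^-1.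
  by rewrite -quot_pi_morph_sigma wm (morphV_of (@quot_pi_morphM _ _)).
have xE : (x : quot (frattiniN p N)) = quot_pi (frattiniN p N) w * ((quot_pi (frattiniN p N) w)^-1 * x).
  by rewrite mulgA mulgV mul1g.
rewrite /minus_part /= {1}xE sigmaM am vm -invgM; congr _^-1.
by rewrite [RHS]xE; exact: aC.
Qed.

Lemma measurable_quot_fiber (M : sigmaNormal Fn) (y : quot M) : open (normal_carrier M) ->
  measurable [set a : minus_borel Fn | quot_pi M (minus_val a) = y].
Proof.
move=> Mo; apply: sub_sigma_algebra.
apply: (@open_comp _ _ (set_val : minus_type Fn -> Fn) [set x | quot_pi M x = y]).
  by move=> a _; exact: initial_continuous.
have [] // := @clopen_translates _ _ [set x | quot_pi M x = y] Mo _ _.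
  by case: (normal_carrierP M).
by move=> a b /quot_pi_eq e /= <-.
Qed.

(** The event is the disjoint union, over ordered bases t of V, of the boxes where q(r_i) = t_i for
    all i. Each box has the n-th power of a Haar fiber as measure, so the value is the number of
    bases times that power. *)
Lemma relator_fiber_measure :
  measurable [set r : n.-tuple (minus_borel Fn) | closed_gen (relators r) = normal_carrier N] /\
  power_measure (haar n) n [set r | closed_gen (relators r) = normal_carrier N] =
    (((\prod_(i < n) (p ^ n - p ^ i))%N%:R / (card_set (minus_part G) * p ^ n)%N%:R ^+ n)%R : R)%:E.
Proof.
pose T : pred (n.-tuple E) := [pred t : n.-tuple E | all (mem V) t && (#|<<[set x in t]%SET>>| == p ^ n)%N].
pose B (t : n.-tuple E) (i : 'I_n) := [set a : minus_borel Fn | q (minus_val a) = tnth t i].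
pose S (t : n.-tuple E) := if T t then [set r : n.-tuple (minus_borel Fn) | forall i, B t i (tnth r i)] else set0.
have mB t i : measurable (B t i) by apply: measurable_quot_fiber; exact: fiber_frattini_open.
have mS t : measurable (S t).
  by rewrite /S; case: ifP => // _; apply: measurable_box.
have SP t r : S t r <-> T t /\ map_tuple (fun a => q (minus_val a)) r = t.
  rewrite /S; case: ifP => Tt; split=> //; last by case.
    by move=> h; split=> //; apply: eq_from_tnth => i; rewrite tnth_map; exact: h.
  by move=> [_ <-] i; rewrite /B /= tnth_map.
have [|mA e] := @multicover_measure _ _ R (power_measure (haar n) n) _ S
  [set r | closed_gen (relators r) = normal_carrier N] 1 isT mS.
  move=> r; rewrite muln1; pose t := map_tuple (fun a => q (minus_val a)) r.
  have Tt : T t = `[< closed_gen (relators r) = normal_carrier N >].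
    apply/idP/asboolP => [/andP[Vt /eqP ct]|/(closed_gen_relators_eq p_pr FP fiber_open fiber_frattini_open) [Vt gent]].
      apply/(closed_gen_relators_eq p_pr FP fiber_open fiber_frattini_open); split=> //.
      by apply/eqP; rewrite finset.eqEcard gen_seq_sub //= ct card_frattini_image.
    by apply/andP; split=> //; rewrite gent card_frattini_image.
  rewrite -Tt; case Tt': (T t).
    rewrite -[RHS](card1 t); apply: eq_card => u; apply/asboolP/eqP => [/SP[_ <-] //|->].
    by apply/SP.
  apply: eq_card0 => u; apply/negP => /asboolP/SP[Tu ut].
  by rewrite -/t in ut; rewrite ut Tu in Tt'.
split=> //; rewrite mul1e in e; rewrite e.
transitivity (\sum_(t : n.-tuple E | T t) (((card_set (minus_part (quot (frattiniN p N))))%:R^-1 ^+ n)%R : R)%:E)%E.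
  rewrite [RHS]big_mkcond /=; apply: eq_bigr => t _; rewrite /S; case: ifP => Tt;
    last by rewrite measure0.
  rewrite power_measureE //.
  rewrite (eq_bigr (fun=> (((card_set (minus_part (quot (frattiniN p N))))%:R^-1)%R : R)%:E));
    last first.
    move=> i _; apply: (haarP fiber_frattini_open).
    by apply: frattini_image_minus; case/andP: Tt => /allP h _; apply: h; exact: mem_tnth.
  by rewrite prodEFin prodr_const card_ord.
rewrite sumEFin; congr EFin; rewrite sumr_const -[#|_|]/(#|T|).
rewrite (card_free_tuples p_pr (frattini_image_abelem p_pr FP fiber_frattini_open) n card_frattini_image).
rewrite card_minus_frattini -[LHS]mulr_natl exprVn.
reflexivity.
Qed.

End FiberMeasure.

(** * Automorphisms and surjections with a given kernel *)

Section Factor.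
Local Open Scope classical_set_scope.
Local Open Scope group_scope.

Lemma finite_hausdorff_continuous (T U : topologicalType) (f : T -> U) :
  finite_set [set: T] -> hausdorff_space T -> continuous f.
Proof.
move=> Tfin Th x A nA; apply: open_nbhs_nbhs; split; last exact: (nbhs_singleton nA).
exact: finite_hausdorff_open.
Qed.

Section FactorThrough.
Variables (D H K : sigmaGroupType) (f : D -> H) (g : D -> K).
Hypotheses (fM : {morph f : x y / x * y}) (fs : {morph f : x / sigma x}).
Hypotheses (gM : {morph g : x y / x * y}) (gs : {morph g : x / sigma x}).
Hypothesis f_surj : forall y, exists x, f x = y.

Lemma factor_through : (forall x, f x = 1 -> g x = 1) ->
  exists h : H -> K, [/\ {morph h : x y / x * y}, {morph h : x / sigma x} &
    forall x, h (f x) = g x].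
Proof.
move=> fg; pose h y := g (projT1 (cid (f_surj y))).
have hE x : h (f x) = g x.
  rewrite /h; case: cid => z /= fz; apply: (mulgI (g x)^-1); rewrite mulVg.
  by rewrite -(morphV_of gM) -gM fg // fM (morphV_of fM) fz mulVg.
exists h; split=> // [a b|a].
  by have [x <-] := f_surj a; have [y <-] := f_surj b; rewrite -fM !hE gM.
by have [x <-] := f_surj a; rewrite -fs !hE gs.
Qed.

End FactorThrough.

Lemma sigma_isomorphic_quot (D G : sigmaGroupType) (f : D -> G) (N : sigmaNormal D) :
  finite_set [set: G] -> hausdorff_space G -> continuous f ->
  {morph f : x y / x * y} -> {morph f : x / sigma x} ->
  (forall y, exists x, f x = y) -> (forall x, normal_carrier N x <-> f x = 1) ->
  sigma_isomorphic G (quot N).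
Proof.
move=> Gfin Gh fc fM fs f_surj kerf.
have [|h [hM hs hE]] := factor_through fM fs (@quot_pi_morphM _ N) (@quot_pi_morph_sigma _ N) f_surj.
  by move=> x /kerf/quot_pi_eq1.
have [|g [gM gs gE]] := factor_through (@quot_pi_morphM _ N) (@quot_pi_morph_sigma _ N) fM fs (@quot_pi_surj _ N).
  by move=> x /quot_pi_eq1/kerf.
exists h; split=> //; first exact: finite_hausdorff_continuous.
exists g; split=> [|y|a]; last 2 first.
- by have [x <-] := f_surj y; rewrite hE gE.
- by have [x <-] := quot_pi_surj a; rewrite gE hE.
apply/quotient_continuous.
have -> : g \o \pi_(quot N)%qT = f by apply/funext => x; exact: gE.
exact: fc.
Qed.

(* Automorphisms of [G] act simply transitively on the surjections with a given
   kernel. *)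
Lemma sigma_aut_between (D G : sigmaGroupType) (f g : D -> G) :
  finite_set [set: G] -> hausdorff_space G ->
  {morph f : x y / x * y} -> {morph f : x / sigma x} -> (forall y, exists x, f x = y) ->
  {morph g : x y / x * y} -> {morph g : x / sigma x} -> (forall y, exists x, g x = y) ->
  (forall x, f x = 1 <-> g x = 1) ->
  exists2 h, Aut_sigma G h & forall x, h (f x) = g x.
Proof.
move=> Gfin Gh fM fs f_surj gM gs g_surj fg.
have [|h [hM hs hE]] := factor_through fM fs gM gs f_surj; first by move=> x /fg.
have [|k [kM ks kE]] := factor_through gM gs fM fs g_surj; first by move=> x /fg.
exists h => //; split=> //; first exact: finite_hausdorff_continuous.
exists k; split=> [|y|y]; first exact: finite_hausdorff_continuous.
- by have [x <-] := f_surj y; rewrite hE kE.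
- by have [x <-] := g_surj y; rewrite kE hE.
Qed.

Lemma card_set_fin (T : finType) (B : set T) : card_set B = #|[pred t | `[< B t >]]|.
Proof.
rewrite /card_set cardE; apply/perm_size/uniq_perm.
- exact: fset_uniq.
- exact: enum_uniq.
move=> x; rewrite in_fset_set; last exact: (@finite_finset T B).
by apply/esym; exact: (mem_enum [pred t | `[< B t >]] x).
Qed.

Lemma card_set_image (T U : choiceType) (A : set T) (f : T -> U) :
  {in A &, injective f} -> finite_set (f @` A) -> card_set (f @` A) = card_set A.
Proof.
move=> fi [k fk]; have e := inj_card_eq fi.
rewrite /card_set (card_fset_set fk); apply/esym/card_fset_set.
by apply: card_eq_trans fk; rewrite card_eq_sym.
Qed.

End Factor.

Section SchMeasure.
Local Open Scope classical_set_scope.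
Local Open Scope group_scope.
Variables (R : realType) (p : nat) (F : free_sigma_system p).
Variable haar : forall n, probability (minus_borel (F n)) R.
Hypotheses (p_pr : prime p) (p_gt2 : (2 < p)%N) (haarP : forall n, is_haar (haar n)).
Variables (G : sigmaGroupType) (GP : pro_p p G) (Gfin : finite_set [set: G]).

Let Gh : hausdorff_space G. Proof. by case: GP. Qed.

Lemma weak_schur_presentation : weak_schur F G ->
  exists m (r : m.-tuple (minus_borel (F m))) (g : F m -> G),
  [/\ continuous g, {morph g : x y / x * y}, {morph g : x / sigma x},
    forall y, exists x, g x = y & forall x, g x = 1 <-> closed_gen (relators r) x].
Proof.
move=> [_ [[m r] [h [hc hM hs [k [kc hk kh]]]]]].
have kM : {morph k : x y / x * y} by move=> x y; rewrite -[x in LHS]kh -[y in LHS]kh -hM hk.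
have ks : {morph k : x / sigma x} by move=> x; rewrite -[x in LHS]kh -hs hk.
exists m, r, (k \o quot_pi (relator_normal r)); split.
- by move=> x; apply: continuous_comp; [exact: quot_pi_continuous|exact: kc].
- by move=> x y /=; rewrite quot_pi_morphM kM.
- by move=> x /=; rewrite quot_pi_morph_sigma ks.
- by move=> y; have [x xy] := quot_pi_surj (h y); exists x; rewrite /= xy hk.
move=> x /=; rewrite -[X in _ <-> X]/(normal_carrier (relator_normal r) x) -quot_pi_eq1.
split=> [kx|->]; last exact: morph1_of.
by rewrite -[LHS]kh kx; exact: morph1_of.
Qed.

Section Count.
Variable n : nat.
Local Notation Gf := (fin_copy Gfin).

Definition generating_minus (t : n.-tuple Gf) : bool :=
  [forall i, `[< minus_part G (tnth t i) >]] && (<<[set x in t]%SET>> == [set: Gf]%SET).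

Definition hom_on_tuple (t : n.-tuple Gf) (f : F n -> G) : Prop :=
  [/\ continuous f, {morph f : x y / x * y}, {morph f : x / sigma x} &
    forall i, f (free_gen F i) = tnth t i].

Lemma generating_minus_hom t : generating_minus t ->
  exists2 f, hom_on_tuple t f & forall y, exists x, f x = y.
Proof.
move=> /andP[/forallP tm /eqP tg].
have [f [fc fM fs fE]] := free_sigma_hom F GP (fun i => asboolW (tm i)).
exists f => //; have [K KP] := @image_group (F n) Gf f setT fM (And3 I (fun _ _ _ _ => I) (fun _ _ => I)).
move=> y; have : (y : Gf) \in K.
  have : (y : Gf) \in <<[set x in t]%SET>> by rewrite tg finset.in_setT.
  apply/fintype.subsetP; rewrite gen_subG; apply/fintype.subsetP => z.
  by rewrite inE => /tnthP[i ->]; apply/KP; exists (free_gen F i).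
by move/KP => [x _ fx]; exists x.
Qed.

Lemma surj_generating_minus t f : hom_on_tuple t f -> (forall y, exists x, f x = y) ->
  generating_minus t.
Proof.
move=> [fc fM fs fE] f_surj; apply/andP; split.
  by apply/forallP => i; apply/asboolP;
    rewrite -fE /minus_part /= -fs free_gen_sigma (morphV_of fM).
rewrite finset.eqEsubset finset.subsetT /=; apply/fintype.subsetP => y _.
have [x <-] := f_surj y.
suff /seteqP[_ /(_ x I)] : [set x | (f x : Gf) \in <<[set x in t]%SET>>] = setT by [].
apply: (free_gen_generate p_pr).
- apply: (@preimage_closed _ _ f [set x : G | (x : Gf) \in <<[set x in t]%SET>>]) => [z _|];
  first exact: fc.
  by rewrite -[X in closed X]setCK; apply: open_closedC; exact: finite_hausdorff_open.
- apply: (subgroup_preim (L := Gf) (P := fun z => z \in <<[set x in t]%SET>>) fM) => //.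
  + by move=> *; exact: (@groupM Gf <<_>>%G).
  + by move=> * ; rewrite (@groupV Gf <<_>>%G).
- by move=> i /=; rewrite fE; apply: mem_gen; rewrite inE mem_tnth.
Qed.

(** A surjection F_n -> G with kernel N_r is recorded by its values on the free generators, so that
    finitely many events cover all such surjections. *)
Definition kernel_tuples (r : n.-tuple (minus_borel (F n))) (t : n.-tuple Gf) : Prop :=
  exists f, [/\ hom_on_tuple t f, forall y, exists x, f x = y &
    forall x, closed_gen (relators r) x <-> f x = 1].

(** Given one surjection f0 with kernel N_r, the others are a f0 with a in Aut_sigma(G), and a is
    recovered from the tuple by uniqueness on F_n and surjectivity of f0. The boolean factor covers
    the case without any. *)
Lemma card_kernel_tuples r : #|[pred t | `[< kernel_tuples r t >]]| =
  (`[< sigma_isomorphic G (quot (relator_normal r)) >] * card_set (Aut_sigma G))%N.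
Proof.
rewrite -[LHS](card_set_fin (kernel_tuples r)).
case: asboolP => [[h [hc hM hs [k [kc hk kh]]]]|niso]; last first.
  rewrite mul0n card_set_fin; apply: eq_card0 => t;
    apply/negP => /asboolP[f [[fc fM fs _] f_surj fk]].
  by apply: niso; exact: (@sigma_isomorphic_quot _ _ f (relator_normal r) Gfin Gh fc fM fs f_surj fk).
rewrite mul1n.
have kM : {morph k : x y / x * y} by move=> x y; rewrite -[x in LHS]kh -[y in LHS]kh -hM hk.
have ks : {morph k : x / sigma x} by move=> x; rewrite -[x in LHS]kh -hs hk.
pose f0 := k \o quot_pi (relator_normal r).
have f0c : continuous f0.
  by move=> x; apply: continuous_comp; [exact: quot_pi_continuous|exact: kc].
have f0M : {morph f0 : x y / x * y} by move=> x y; rewrite /f0 /= quot_pi_morphM kM.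
have f0s : {morph f0 : x / sigma x} by move=> x; rewrite /f0 /= quot_pi_morph_sigma ks.
have f0_surj y : exists x, f0 x = y.
  by have [x xy] := quot_pi_surj (h y); exists x; rewrite /f0 /= xy hk.
have f0k x : closed_gen (relators r) x <-> f0 x = 1.
  rewrite -[X in X <-> _]/(normal_carrier (relator_normal r) x) -quot_pi_eq1.
  split=> [kx|e]; first by rewrite /f0 /= kx; exact: morph1_of.
  by rewrite -[LHS]kh -[RHS](morph1_of hM); congr h; exact: e.
pose tup (a : G -> G) : n.-tuple Gf := [tuple (a (f0 (free_gen F i)) : Gf) | i < n].
have homA a : Aut_sigma G a -> hom_on_tuple (tup a) (a \o f0).
  move=> [ac aM as_ _]; split.
  - by move=> x; apply: continuous_comp; [exact: f0c|exact: ac].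
  - exact: morph_comp.
  - by move=> x /=; rewrite f0s as_.
  - by move=> i; rewrite tnth_mktuple.
have -> : kernel_tuples r = tup @` Aut_sigma G.
  apply/seteqP; split=> [t [f [[fc fM fs fE] f_surj fk]]|_ [a Aa <-]].
    have [|a Aa aE] := sigma_aut_between Gfin Gh f0M f0s f0_surj fM fs f_surj.
      by move=> x; rewrite -f0k.
    by exists a => //; apply: eq_from_tnth => i; rewrite tnth_mktuple aE.
  exists (a \o f0); case: (Aa) => _ aM _ [b [_ ab ba]]; split; first exact: homA.
    by move=> y; have [x fx] := f0_surj (b y); exists x; rewrite /= fx ba.
  move=> x; rewrite f0k /=; split=> [->|e]; first exact: morph1_of.
  by rewrite -[LHS]ab e -[X in b X](morph1_of aM) ab.
apply: card_set_image; last exact: (@finite_finset _ _).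
move=> a b /set_mem Aa /set_mem Ab tab; apply/funext => y.
have [x <-] := f0_surj y.
have [ac aM _ _] := homA _ Aa; have [bc bM _ _] := homA _ Ab.
apply: (free_hom_uniq GP ac aM bc bM) => i.
have := congr1 (fun t => tnth t i) tab.
by rewrite !tnth_mktuple.
Qed.

End Count.
End SchMeasure.

Section TupleCounts.
Local Open Scope nat_scope.

Lemma card_all_tuples (T : finType) (P : pred T) n :
  #|[pred t : n.-tuple T | all P t]| = #|P| ^ n.
Proof.
elim: n => [|n IH].
  by rewrite expn0 -[RHS](card_tuple 0 T); apply: eq_card => t; rewrite !inE tuple0.
rewrite card_cons_tuple expnS mulnC -IH -[X in (X * _)%N]sum1_card big_distrl /= [RHS]big_mkcond /=.
apply: eq_bigr => t _; rewrite inE mul1n; case: ifP => Pt.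
  by apply: eq_card => x; rewrite inE /= andbT.
by apply: eq_card0 => x; rewrite inE /= andbF.
Qed.

End TupleCounts.

(** * Generating tuples and the measure of the class at level n *)

Section SchMeasure.
Local Open Scope classical_set_scope.
Local Open Scope group_scope.
Variables (R : realType) (p : nat) (F : free_sigma_system p).
Variable haar : forall n, probability (minus_borel (F n)) R.
Hypotheses (p_pr : prime p) (p_gt2 : (2 < p)%N) (haarP : forall n, is_haar (haar n)).
Variables (G : sigmaGroupType) (GS : weak_schur F G) (Gfin : finite_set [set: G]).

Let GP : pro_p p G := GS.1.
Let Gh : hausdorff_space G. Proof. by case: GP. Qed.
Local Notation Gf := (fin_copy Gfin).
Local Notation qm := (card_set (minus_part G)).
Local Notation gen_count n := #|[pred t : n.-tuple Gf | generating_minus t]|.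

(** [card_set] is 0 on infinite sets, so finiteness has to enter: automorphisms embed into the
    functions on a finite type. *)
Lemma card_Aut_gt0 : (0 < card_set (Aut_sigma G))%N.
Proof.
pose phi (a : G -> G) : {ffun Gf -> Gf} := [ffun x : Gf => (a x : Gf)].
rewrite -(@card_set_image _ _ (Aut_sigma G) phi); last exact: (@finite_finset _ _).
  rewrite card_set_fin; apply/card_gt0P; exists (phi idfun); apply/asboolP.
  exists idfun => //; split=> // [x|]; first exact: cvg_id.
  by exists idfun; split=> // x; exact: cvg_id.
move=> a b _ _ /ffunP ab; apply/funext => x.
by have := ab (x : Gf); rewrite !ffunE.
Qed.

Lemma card_minusE : qm = #|[pred x : Gf | `[< minus_part G x >]]|.
Proof. exact: card_fin_copy. Qed.

Lemma card_minus_gt0 : (0 < qm)%N.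
Proof. by rewrite card_minusE; apply/card_gt0P; exists 1; apply/asboolP; exact: minus1. Qed.

Lemma generating_minusE n (t : n.-tuple Gf) : generating_minus t =
  all [pred x : Gf | `[< minus_part G x >]] t && (<<[set x in t]%SET>> == [set: Gf]%SET).
Proof.
congr (_ && _); apply/forallP/allP => [h x /tnthP[i ->]|h i]; first exact: h.
exact: h (mem_tnth i t).
Qed.

Lemma gen_count_le n : (gen_count n <= qm ^ n)%N.
Proof.
rewrite card_minusE -card_all_tuples; apply: subset_leq_card.
by apply/fintype.subsetP => t; rewrite !inE generating_minusE => /andP[].
Qed.

(* A tuple that runs through all of [G^-] generates [G]. *)
Lemma gen_count_ge n : (qm ^ n <= gen_count n + qm * qm.-1 ^ n)%N.
Proof.
have [m [r [g [gc gM gs g_surj _]]]] := weak_schur_presentation GS.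
have : exists2 t0 : m.-tuple Gf, all [pred x : Gf | `[< minus_part G x >]] t0 &
    <<[set x in t0]%SET>> = [set: Gf]%SET.
  pose t0 : m.-tuple Gf := [tuple (g (free_gen F i) : Gf) | i < m].
  have h : hom_on_tuple (F := F) t0 g by split=> // i; rewrite tnth_mktuple.
  have := surj_generating_minus p_pr GP h g_surj.
  by rewrite generating_minusE => /andP[? /eqP ?]; exists t0.
move=> [t0 t0m t0g].
pose P := [pred x : Gf | `[< minus_part G x >]].
rewrite card_minusE -[X in (X <= _)%N]card_all_tuples -/P.
have miss (a : Gf) : P a -> #|[pred t : n.-tuple Gf | all (predD1 P a) t]| = (#|P|.-1 ^ n)%N.
  by move=> Pa; rewrite card_all_tuples (cardD1 a P) [a \in P]Pa.
rewrite -[X in (_ <= _ + X * _)%N]sum1_card big_distrl /=.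
rewrite (eq_bigr (fun a => #|[pred t : n.-tuple Gf | all (predD1 P a) t]|)); last first.
  by move=> a Pa; rewrite mul1n miss.
have cardE' (Q : pred (n.-tuple Gf)) : #|Q| = (\sum_t Q t)%N.
  by rewrite -sum1_card big_mkcond; apply: eq_bigr => t _; rewrite -[t \in Q]/(Q t); case: (Q t).
rewrite !cardE' (eq_bigr _ (fun a _ => cardE' _)) exchange_big -big_split /=.
apply: leq_sum => t _; case Pt: (all P t) => //=.
have [//|gt] := boolP (generating_minus t); rewrite add0n.
(* A tuple missing no element of G^- would contain the generators [t0]. So a non-generating tuple
   avoids some a in G^-, and for each a there are (|G^-| - 1)^n tuples in G^- that do. *)
have [a Pa at_] : exists2 a, P a & a \notin tval t.
  apply: contrapT => h; case/negP: gt; rewrite generating_minusE Pt /= -t0g.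
  rewrite finset.eqEsubset; apply/andP; split; first by rewrite t0g finset.subsetT.
  rewrite gen_subG; apply/fintype.subsetP => x; rewrite inE => t0x.
  apply: mem_gen; rewrite inE; apply: contraT => tx; case: h; exists x => //.
  exact: allP t0m _ t0x.
rewrite (bigD1 a) //=.
have -> : all (predD1 P a) t; last by [].
apply/allP => x tx; apply/andP; split; last exact: (allP Pt _ tx).
by apply: contraNneq at_ => <-.
Qed.

Local Notation relator_prob n :=
  (((\prod_(i < n) (p ^ n - p ^ i))%N%:R / (qm * p ^ n)%N%:R ^+ n)%R : R).

(** The events [kernel_tuples r t] cover the event that G_r is isomorphic to G with multiplicity
    |Aut_sigma(G)|. They are empty unless t generates, and otherwise have one common probability.
    The threshold m is the number of generators of a fixed presentation of G, which
    [kernel_presentation] pads to n. *)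
Lemma mu_n_sch_class : exists m, forall n, (m <= n)%N ->
  ((card_set (Aut_sigma G))%:R%:E * mu_n haar n [set sch_class GS] =
    ((gen_count n)%:R * relator_prob n)%:E)%E.
Proof.
have [m [r0 [g [gc gM gs g_surj gk]]]] := weak_schur_presentation GS.
exists m => n mn.
have main (t : n.-tuple Gf) : generating_minus t ->
    measurable [set r | kernel_tuples (F := F) r t] /\
    power_measure (haar n) n [set r | kernel_tuples (F := F) r t] = (relator_prob n)%:E.
  move=> /(generating_minus_hom F GP)[f [fc fM fs fE] f_surj].
  have [s es] := kernel_presentation p_pr p_gt2 GP Gfin fc fM fs
    (haar_minus_lift (free_pro_pP F n) (@haarP n) GP Gfin fc fM fs f_surj)
    gc gM gs g_surj gk mn.
  have := relator_fiber_measure p_pr haarP GP Gfin fc f_surj es.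
  suff -> : [set r | kernel_tuples r t] =
      [set r | closed_gen (relators r) = normal_carrier (kernelN fM fs)] by [].
  apply/seteqP; split=> r.
    move=> [f' [[fc' fM' fs' fE'] _ fk']]; apply/seteqP.
    have ff' : f =1 f' by apply: (free_hom_uniq GP fc fM fc' fM') => i; rewrite fE fE'.
    by split=> x /=; rewrite ff' => /fk'.
  move=> e; exists f; split=> // x.
  by rewrite -[X in _ <-> X]/(normal_carrier (kernelN fM fs) x) -e.
pose S (t : n.-tuple Gf) := [set r | kernel_tuples (F := F) r t].
have S0 t : ~~ generating_minus t -> S t = set0.
  move=> /negP gt; apply/seteqP; split=> // r [f [ft f_surj _]]; apply: gt.
  exact: surj_generating_minus ft f_surj.
have mS t : measurable (S t).
  by case gt: (generating_minus t); [case: (main t gt)|rewrite S0 ?gt].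
have [r|mA e] := @multicover_measure _ _ R (power_measure (haar n) n) _ S
  [set r | sigma_isomorphic G (quot (relator_normal r))] (card_set (Aut_sigma G)) card_Aut_gt0 mS.
  exact: (card_kernel_tuples GP).
rewrite /mu_n /pushforward.
have -> : @sch_of_relators p F n @^-1` [set sch_class GS] =
    [set r | sigma_isomorphic G (quot (relator_normal r))].
  apply/seteqP; split=> r /=.
    by move=> /esym/sch_class_eq.
  by move=> iso; apply/esym/sch_class_eq.
rewrite e (eq_bigr (fun t => if generating_minus t then (relator_prob n)%:E else 0%E)); last first.
  by move=> t _; case: ifP => gt; [case: (main t gt)|rewrite S0 ?gt // measure0].
rewrite -big_mkcond sumEFin /=; congr EFin.
rewrite (eq_bigl (fun t => t \in [pred t : n.-tuple Gf | generating_minus t])) //.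
by rewrite sumr_const [RHS]mulr_natl.
Qed.

End SchMeasure.

(** * The limit *)

Section Limit.
Local Open Scope classical_set_scope.
Local Open Scope ring_scope.
Variable R : realType.

Definition euler_partial (p n : nat) : R := \prod_(1 <= i < n.+1) (1 - p%:R ^- i).

Lemma euler_partialE (p n : nat) : (0 < p)%N ->
  (\prod_(i < n) (p ^ n - p ^ i))%N%:R / (p ^ n)%N%:R ^+ n = euler_partial p n.
Proof.
move=> p_gt0; have p0 : (p%:R : R) != 0 by rewrite pnatr_eq0 -lt0n.
rewrite /euler_partial big_add1 -pred_Sn -[in LHS](big_mkord xpredT (fun i => p ^ n - p ^ i)%N).
(* Reversing the order turns (p^n - p^(n-i-1)) / p^n into the factor 1 - p^-(i+1). *)
rewrite big_nat_rev add0n /= natr_prod -[X in _ ^+ X](subn0 n) -prodr_const_nat -prodf_div.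
rewrite !big_nat; apply: eq_bigr => i /andP[_ i_n].
rewrite natrB; last by rewrite leq_pexp2l // leq_subr.
rewrite mulrBl divff ?pnatr_eq0 ?expn_eq0 -?lt0n ?p_gt0 ?negb_and //; last by rewrite -lt0n p_gt0.
congr (1 - _); rewrite !natrX -[X in _ / _ ^+ X](subnK i_n) exprD invfM mulrA divff ?mul1r //.
exact: expf_neq0.
Qed.

(** [C_infty] is itself a [limn], so only existence of the limit is at stake: the partial products
    decrease and are nonnegative. *)
Lemma euler_partial_cvg (p : nat) : (1 < p)%N -> euler_partial p @ \oo --> C_infty R p.
Proof.
move=> p_gt1.
have fac i : 0 <= 1 - p%:R ^- i :> R.
  rewrite subr_ge0 invf_le1; last by rewrite exprn_gt0 // ltr0n ltnW.
  by rewrite exprn_ege1 // ler1n ltnW.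
have fac1 i : 1 - p%:R ^- i <= 1 :> R.
  by rewrite gerBl invr_ge0 exprn_ge0.
apply: nonincreasing_is_cvgn.
  apply/nonincreasing_seqP => n; rewrite /euler_partial [leLHS]big_nat_recr //=.
  by apply: ler_piMr => //; apply: prodr_ge0.
by exists 0 => _ [n _ <-]; apply: prodr_ge0.
Qed.

(** The ratio is squeezed between 1 - q ((q-1)/q)^n and 1. *)
Lemma cvg_count_ratio (q : nat) (c : nat -> nat) : (0 < q)%N ->
  (forall n, c n <= q ^ n)%N -> (forall n, q ^ n <= c n + q * q.-1 ^ n)%N ->
  ((c n)%:R / q%:R ^+ n : R) @[n --> \oo] --> (1 : R).
Proof.
move=> q_gt0 cle cge; have q0 : 0 < (q%:R : R) by rewrite ltr0n.
have qn n : 0 < (q%:R ^+ n : R) by rewrite exprn_gt0.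
apply: (@squeeze_cvgr _ _ _ _ (fun n => 1 - q%:R * (q.-1%:R / q%:R) ^+ n) (fun=> 1)).
- apply: nearW => n; apply/andP; split; last by rewrite ler_pdivrMr // mul1r -natrX ler_nat.
  rewrite ler_pdivlMr // mulrBl mul1r -mulrA -exprMn divfK ?gt_eqF // lerBlDr.
  by rewrite -!natrX -natrM -natrD ler_nat.
- rewrite -[X in _ --> X]subr0; apply: cvgB; first exact: cvg_cst.
  rewrite -[X in _ --> X](mulr0 (q%:R : R)); apply: cvgM; first exact: cvg_cst.
  apply: cvg_expr; rewrite ger0_norm ?divr_ge0 // ltr_pdivrMr // mul1r ltr_nat.
  by rewrite prednK.
- exact: cvg_cst.
Qed.

Lemma limn_eventually_EFin (u : nat -> \bar R) (v : nat -> R) (l : R) (m : nat) :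
  (forall n, (m <= n)%N -> u n = (v n)%:E) -> v @ \oo --> l -> limn u = l%:E.
Proof.
move=> uv vl; apply: cvg_lim => //; rewrite -(cvg_shiftn m).
have -> : (fun n => u (n + m)%N) = EFin \o (fun n => v (n + m)%N).
  by apply/funext => n; rewrite /= uv // leq_addl.
apply/fine_cvgP; split; first exact: nearW.
by rewrite (cvg_shiftn m).
Qed.

End Limit.

Section MuInfty.
Local Open Scope classical_set_scope.
Local Open Scope ring_scope.
Variables (R : realType) (p : nat) (F : free_sigma_system p).
Variable haar : forall n, probability (minus_borel (F n)) R.
Hypotheses (p_pr : prime p) (p_gt2 : (2 < p)%N) (haarP : forall n, is_haar (haar n)).
Variables (G : sigmaGroupType) (GS : weak_schur F G) (Gfin : finite_set [set: G]).

Lemma mu_infty_sch_class : mu_infty haar [set sch_class GS] =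
  (C_infty R p / (card_set (Aut_sigma G))%:R)%:E.
Proof.
have [m mE] := mu_n_sch_class p_pr p_gt2 haarP GS Gfin.
pose c n := #|[pred t : n.-tuple (fin_copy Gfin) | generating_minus t]|.
set a := card_set (Aut_sigma G); set q := card_set (minus_part G).
have a0 : (a%:R : R) != 0 by rewrite pnatr_eq0 -lt0n; exact: card_Aut_gt0.
have q_gt0 : (0 < q)%N := card_minus_gt0 Gfin.
apply: (@limn_eventually_EFin _ _ (fun n => (c n)%:R / q%:R ^+ n * euler_partial R p n / a%:R) _ m).
  move=> n /mE; rewrite -/a -/q -/(c n) => e.
  have -> : mu_n haar n [set sch_class GS] = (a%:R^-1%:E * (a%:R%:E * mu_n haar n [set sch_class GS]))%E.
    by rewrite muleA -EFinM mulVf // mul1e.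
  rewrite e -EFinM mulrC -euler_partialE ?prime_gt0 //; congr (_ / _)%:E.
  by rewrite natrM exprMn invfM !mulrA; congr (_ / _); rewrite -!mulrA; congr (_ * _);
    rewrite mulrC.
rewrite -[X in X / _]mul1r; apply: cvgM; last exact: cvg_cst.
apply: cvgM; last by apply: euler_partial_cvg; exact: prime_gt1.
apply: cvg_count_ratio => // n; first exact: gen_count_le.
exact: (gen_count_ge p_pr GS Gfin).
Qed.

End MuInfty.

(** * Isolated points of Sch *)

Section ZassenhausSeries.
Local Open Scope classical_set_scope.
Local Open Scope group_scope.
Variables (p : nat).
Hypothesis p_pr : prime p.

Let p1 : p != 1%N. Proof. by case: eqP p_pr => // ->. Qed.

(** Suppose D_i = D_M with M >= p i. A generator of D_M is a p-th power from index ceil(M/p) >= i,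
    or a commutator with indices k + l = M, one of which is at least i. The filtration is constant
    from i to M, so that index can be raised by one where necessary, and the generator lies in
    D_(M+1). *)
Lemma zassenhaus_stable (G : topGroupType) i m : (0 < i)%N -> (p * i <= m)%N ->
  zassenhaus p G i `<=` zassenhaus p G m ->
  forall j, (i <= j)%N -> zassenhaus p G i `<=` zassenhaus p G j.
Proof.
move=> i_gt0 im Dim j ij; have p_gt1 := prime_gt1 p_pr; have p_gt0 := prime_gt0 p_pr.
have step M : (m <= M)%N -> zassenhaus p G i `<=` zassenhaus p G M ->
    zassenhaus p G i `<=` zassenhaus p G M.+1.
  move=> mM DiM; apply: (subset_trans DiM).
  have iM : (p * i <= M)%N by apply: leq_trans mM.
  have Dk k : (i <= k)%N -> (k <= M)%N -> zassenhaus p G i = zassenhaus p G k.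
    move=> ik kM; apply/seteqP; split; last exact: zassenhaus_sub.
    by apply: (subset_trans DiM); exact: zassenhaus_sub.
  rewrite zassenhausE //; last by nia.
  rewrite [X in _ `<=` X]zassenhausE //; last by nia.
  have cM : (i <= (M + p.-1) %/ p)%N by rewrite leq_divRL //; nia.
  have cM1 : (i <= (M.+1 + p.-1) %/ p)%N by rewrite leq_divRL //; nia.
  have cM' : ((M + p.-1) %/ p <= M)%N by apply/ltnW/ceil_lt => //; nia.
  have cM1' : ((M.+1 + p.-1) %/ p <= M)%N by rewrite -ltnS; apply: ceil_lt => //; nia.
  apply: closed_gen_sub; [exact: closed_gen_closed|exact: closed_gen_subgroup|].
  move=> _ [[x Dx <-]|[k [l [x [y [/andP[k0 l0] kl Dx Dy ->]]]]]]; apply: sub_closed_gen.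
    by left; exists x => //; rewrite -Dk // (Dk _ cM cM').
  right; have [ik|ki] := leqP i k.
    exists k.+1, l, x, y; split=> //; first by rewrite -kl.
    by rewrite -Dk ?(Dk k) //; lia.
  have il : (i <= l)%N by nia.
  exists k, l.+1, x, y; split=> //; [by rewrite k0|by rewrite -kl addnS|].
  by rewrite -Dk ?(Dk l) //; lia.
have [jm|/ltnW mj] := leqP j m.
  by apply: (subset_trans Dim); exact: zassenhaus_sub.
rewrite -(subnKC mj); elim: (j - m)%N => [|d IH]; first by rewrite addn0.
by rewrite addnS; apply: step => //; exact: leq_addr.
Qed.

(** Writing D_i as D_j for a large j shows that D_i is contained in the closure of D_i^p [D_i, G];
    the Frattini argument with A = 1 kills it. *)
Lemma zassenhaus_stable_trivial (G : sigmaGroupType) i : pro_p p G -> (0 < i)%N ->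
  (forall j, (i <= j)%N -> zassenhaus p G i `<=` zassenhaus p G j) ->
  zassenhaus p G i `<=` [set 1].
Proof.
move=> GP i_gt0 Di; have p_gt0 := prime_gt0 p_pr; have p_gt1 := prime_gt1 p_pr.
have [_ Gh _ _] := GP.
have [Dg DJ] := zassenhaus_normal p G i; have [D1 DM DV] := Dg.
apply: (frattini_normal p_pr GP _ _ (zassenhaus_normal p G i)).
- exact/accessible_closed_set1/hausdorff_accessible.
- by split; [exact: subgroup_set1|move=> x g ->; rewrite /= conj1g].
- by move=> _ ->.
(* At index 2pi the p-th powers come from an index at least i, and k + l = 2pi leaves k or l at
   least i. *)
have iJ : (i <= 2 * p * i)%N by nia.
apply: (subset_trans (Di _ iJ)); rewrite zassenhausE //; last by nia.
have [_ _ CV] := closed_gen_subgroup ([set 1] `|` frattini_gens p (zassenhaus p G i)).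
apply: closed_gen_sub; [exact: closed_gen_closed|exact: closed_gen_subgroup|].
move=> _ [[x Dx <-]|[k [l [x [y [/andP[k0 l0] kl Dx Dy ->]]]]]].
  apply: sub_closed_gen; right; left; exists x => //.
  by apply: (zassenhaus_sub p1 _ Dx); rewrite leq_divRL //; nia.
have [ik|ki] := leqP i k.
  apply: sub_closed_gen; right; right; exists x, y; split=> //.
  exact: (zassenhaus_sub p1 ik Dx).
rewrite -[[~ x, y]]invgK invg_comm; apply: CV; apply: sub_closed_gen; right; right.
exists y, x; split=> //; apply: (zassenhaus_sub p1 _ Dy); nia.
Qed.

(** The filtration decreases, so it is stationary from an index where its order is minimal. *)
Lemma zassenhaus_finite_trivial (G : sigmaGroupType) : pro_p p G ->
  finite_set [set: G] -> exists2 i, (0 < i)%N & zassenhaus p G i `<=` [set 1].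
Proof.
move=> GP Gfin; pose c i := card_set (zassenhaus p G i.+1).
have [i imin] : exists i, forall j, (c i <= c j)%N.
  have : exists k, exists i, c i == k by exists (c 0%N), 0%N.
  move=> ex; have ex' : exists k, `[< exists i, c i == k >].
    by case: ex => k /asboolP; exists k.
  case: (ex_minnP ex') => k /asboolP[i /eqP <-] kmin; exists i => j.
  by apply: kmin; apply/asboolP; exists j.
exists i.+1 => //; apply: zassenhaus_stable_trivial => // j ij x Dx.
have := imin j.-1; rewrite /c prednK; last exact: leq_ltn_trans ij.
rewrite !(card_fin_copy Gfin) => le.
pose A k : {set fin_copy Gfin} := [set x : fin_copy Gfin | `[< zassenhaus p G k x >]]%SET.
have AP k y : y \in A k <-> zassenhaus p G k y by rewrite inE; split=> /asboolP.
apply/AP; have /eqP -> : A j == A i.+1; last exact/AP.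
rewrite finset.eqEcard; apply/andP; split.
  by apply/fintype.subsetP => y /AP Dy; apply/AP; exact: (zassenhaus_sub p1 ij Dy).
by rewrite !cardsE.
Qed.

End ZassenhausSeries.

(** * The class of a finite G is open and closed *)

Section IsolatedPoint.
Local Open Scope classical_set_scope.
Local Open Scope group_scope.

Lemma sigma_isomorphic_quot1 (H : sigmaGroupType) (N : sigmaNormal H) :
  normal_carrier N `<=` [set 1] -> sigma_isomorphic H (quot N).
Proof.
move=> N1; exists (quot_pi N); split.
- exact: quot_pi_continuous.
- exact: quot_pi_morphM.
- exact: quot_pi_morph_sigma.
have reprE x : repr (quot_pi N x) = x.
  by have /N1 /= e := @repr_pi _ N x; apply: (mulgI x^-1); rewrite mulVg.
exists repr; split=> //; last exact: reprK.
apply/quotient_continuous.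
have -> : repr \o \pi_(quot N)%qT = idfun by apply/funext => x; exact: reprE.
by move=> x; exact: cvg_id.
Qed.

Variables (p : nat).
Hypothesis p_pr : prime p.

Lemma zassenhaus_quot_determines (G : sigmaGroupType) : pro_p p G ->
  finite_set [set: G] -> exists2 m, (2 <= m)%N & forall H : sigmaGroupType, pro_p p H ->
    sigma_isomorphic (quot (zassenhausN p H m)) (quot (zassenhausN p G m)) ->
    sigma_isomorphic H G.
Proof.
have p1 : p != 1%N by case: eqP p_pr => // ->.
have p_gt1 := prime_gt1 p_pr.
move=> GP Gfin; have [i i_gt0 Gi] := zassenhaus_finite_trivial p_pr GP Gfin.
have im : (i <= p * i)%N by nia.
exists (p * i)%N => [|H HP iso]; first by nia.
have Gm : sigma_isomorphic G (quot (zassenhausN p G (p * i))).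
  apply: sigma_isomorphic_quot1; apply: subset_trans Gi.
  exact: (zassenhaus_sub p1 im).
have HG := sigma_isomorphic_trans iso (sigma_isomorphic_sym Gm).
apply: (sigma_isomorphic_trans _ (HG)); apply: sigma_isomorphic_quot1.
have [f [fc fM fs [g [gc fg gf]]]] := HG.
(* The map H -> H / D_(pi)(H) -> G sends D_i(H) into D_i(G) = 1, and its kernel is D_(pi)(H). *)
have Dim : zassenhaus p H i `<=` zassenhaus p H (p * i).
  move=> x Dx; pose psi := f \o quot_pi (zassenhausN p H (p * i)).
  have psic : continuous psi.
    by move=> y; apply: continuous_comp; [exact: quot_pi_continuous|exact: fc].
  have psiM : {morph psi : y z / y * z}.
    by apply: morph_comp => //; exact: quot_pi_morphM.
  have /Gi /= e := zassenhaus_rec_map psic psiM Dx.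
  apply/(@quot_pi_eq1 _ (zassenhausN p H (p * i))).
  by rewrite -[LHS]fg -[RHS]fg (morph1_of fM); congr g; exact: e.
have stab := zassenhaus_stable p_pr i_gt0 (leqnn _) Dim.
apply: subset_trans (zassenhaus_stable_trivial p_pr HP i_gt0 stab).
exact: (zassenhaus_sub p1 im).
Qed.

Variable F : free_sigma_system p.

Lemma sch_basic_open i (G : sigmaGroupType) : (2 <= i)%N -> weak_schur F G ->
  open (@sch_basic p F i G : set (Sch F)).
Proof.
move=> i2 GS; exists [set @sch_basic p F i G]; last exact: bigcup_set1.
by move=> _ ->; exists i, G.
Qed.

(** At the level m that determines G the point is a basic set, and a basic set of level m around any
    other class misses it, because it could contain the class of G only if the two groups were
    isomorphic. *)
Lemma sch_class_clopen (G : sigmaGroupType) (GS : weak_schur F G) :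
  finite_set [set: G] -> open [set sch_class GS] /\ closed [set sch_class GS].
Proof.
move=> Gfin; have [m m2 mG] := zassenhaus_quot_determines GS.1 Gfin; split.
  have -> : [set sch_class GS] = @sch_basic p F m G.
    apply/seteqP; split=> [_ ->|_ [H [HS [-> /(mG _ HS.1) HG]]]].
      by exists G, GS; split=> //; exact: sigma_isomorphic_refl.
    exact/sch_class_eq.
  exact: sch_basic_open.
(* The complement is a union over presentations: sigma-groups form a large type. *)
have -> : [set sch_class GS] = ~` \bigcup_(w in ~` @presentations p F G) @sch_basic p F m (presented_group w).
  apply/seteqP; split=> [_ -> [w nGw [K [KS [/sch_class_eq GK KH]]]]|c cH].
    apply: nGw; apply/sigma_isomorphic_sym/mG; first exact: (weak_schur_presented w).1.
    apply: sigma_isomorphic_trans (sigma_isomorphic_sym KH) _.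
    exact/zassenhaus_iso/sigma_isomorphic_sym.
  apply: contrapT => cG; apply: cH; have [H [HS ec]] := sch_classP c.
  have [w Hw] := HS.2; exists w.
    move=> Gw; apply: cG; rewrite /= ec; apply/sch_class_eq.
    exact: sigma_isomorphic_trans Hw (sigma_isomorphic_sym Gw).
  by exists H, HS; split=> //; exact: zassenhaus_iso.
apply: open_closedC; apply: bigcup_open => w _.
exact/sch_basic_open/weak_schur_presented.
Qed.

End IsolatedPoint.

Local Open Scope classical_set_scope.
Local Open Scope ring_scope.

Theorem proposition10p16 (R : realType) (p : nat) (p_prime : prime p)
    (p_gt2 : (2 < p)%N) (F : free_sigma_system p)
    (haar : forall n, probability (minus_borel (F n)) R)
    (haarP : forall n, is_haar (haar n))
    (G : sigmaGroupType) (GS : weak_schur F G)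
    (Gfin : finite_set [set: G]) :
  [/\ open [set sch_class GS], closed [set sch_class GS] &
      mu_infty haar [set sch_class GS] =
        (C_infty R p / (card_set (Aut_sigma G))%:R)%:E].
Proof.
have [oG cG] := sch_class_clopen p_prime GS Gfin.
by split=> //; exact: mu_infty_sch_class.
Qed.
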